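(* For the decorated hypercubic lattice model described in the context, for every $d\ge1$, every even $L\ge4$ and every real $\mu$, $$\Big(1+\tfrac{e^{-\mu}}{2}\Big)^{-1}\ \ge\ \frac{\langle\hat N_{\rm e}\rangle_\mu}{N_{\rm d}}\ \ge\ 3^{-d}\Big(1+\tfrac{e^{-\mu}}{2}\Big)^{-1},$$ where $N_{\rm d}=L^d$. Moreover, if $d\ge2$, there are positive finite constants $\mu_1,c_1$ depending only on $d$ (not on $L,t,\lambda,U,U'$) such that for all $\mu\ge\mu_1$, $$\frac{\langle\hat N_{\rm e}\rangle_\mu}{N_{\rm d}}\ \ge\ 1-c_1e^{-\mu}.$$
   Context: Let $d\ge1$ and let $L\ge4$ be an even integer. Let $V=(\mathbb Z/L\mathbb Z)^d$ be the $d$-dimensional $L\times\cdots\times L$ hypercubic lattice with periodic boundary conditions, and let $B$ be the set of nearest-neighbour bonds $\{v,w\}$ ($v,w\in V$ at (periodic) Euclidean distance $1$). For each bond $\{v,w\}\in B$ introduce a new site $m(v,w)$ (the midpoint of the bond); let $M$ be the set of these midpoints and $\Lambda=V\cup M$. With fermion operators $c_{x\sigma}$, $x\in\Lambda$, $\sigma\in\{\uparrow,\downarrow\}$, satisfying the canonical anticommutation relations on the fermionic Fock space, $n_{x\sigma}=c^\dagger_{x\sigma}c_{x\sigma}$ and $\hat N_{\rm e}=\sum_x(n_{x\uparrow}+n_{x\downarrow})$, the Hamiltonian is $H=H_{\rm hop}+H_{\rm int}$ with $$H_{\rm hop}=\sum_{\sigma}\sum_{\{v,w\}\in B}t\,(c^\dagger_{v\sigma}+c^\dagger_{w\sigma}+\lambda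 c^\dagger_{m(v,w)\sigma})(c_{v\sigma}+c_{w\sigma}+\lambda c_{m(v,w)\sigma}),$$ $$H_{\rm int}=U\sum_{u\in V}n_{u\uparrow}n_{u\downarrow}+U'\sum_{x\in M}n_{x\uparrow}n_{x\downarrow},$$ where $t>0$, $\lambda>0$, $U>0$, $U'>0$. ($H$ is positive semidefinite.) Let $P_0$ be the orthogonal projection (on the whole Fock space) onto the eigenspace of $H$ with eigenvalue $0$. For an operator $O$ and $\mu\in\mathbb R$ define the grand-canonical ground-state average $$\langle O\rangle_\mu=\frac{\mathrm{Tr}[O\,e^{\mu\hat N_{\rm e}}P_0]}{\mathrm{Tr}[e^{\mu\hat N_{\rm e}}P_0]}.$$ *)

(* Defs.v *)
From HB Require Import structures.
From mathcomp Require Import all_boot all_order all_algebra.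
From mathcomp Require Import reals.
From mathcomp Require Import sequences exp.
Set Implicit Arguments. Unset Strict Implicit. Unset Printing Implicit Defensive.
Import Order.TTheory GRing.Theory Num.Theory.
Local Open Scope ring_scope.

Definition Vtx (d L : nat) := {ffun 'I_d -> 'I_L}.

Definition shift (d L : nat) (v : Vtx d L) (k : 'I_d) : Vtx d L :=
  [ffun j => if j == k then ordS (v j) else v j].

(* Bonds: for L >= 3 the bonds of the periodic lattice are exactly the pairs
   {v, shift v k} (v in V, k < d), all distinct; we index B (and hence the
   midpoints M) by V * 'I_d. *)
Definition Bond (d L : nat) := (Vtx d L * 'I_d)%type.

Definition Site (d L : nat) := (Vtx d L + Bond d L)%type.
Definition vsite d L (v : Vtx d L) : Site d L := inl v.
Definition msite d L (b : Bond d L) : Site d L := inr b.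

(* fermion modes (x, sigma), sigma = true for up, false for down *)
Definition Mode (d L : nat) := (Site d L * bool)%type.

(* occupation-number basis of the fermionic Fock space *)
Definition Conf (d L : nat) := {set Mode d L}.
Definition fdim (d L : nat) := #|{: Conf d L}|.
Definition Op (R : realType) (d L : nat) := 'M[R]_(fdim d L).

Definition conf_of d L (i : 'I_(fdim d L)) : Conf d L := enum_val i.

(* annihilation operator c_{x sigma} (Jordan-Wigner, ordering by enum_rank):
   <S'| c_m |S> = (-1)^{#{y in S | y < m}} if m \in S and S' = S \ {m}. *)
Definition annih (R : realType) d L (m : Mode d L) : Op R d L :=
  \matrix_(i, j)
    (let S' := conf_of i in let S := conf_of j in
     if (m \in S) && (S' == S :\ m) then
       (-1) ^+ #|[set y in S | (enum_rank y < enum_rank m)%N]|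
     else 0).

(* creation operator = adjoint (real matrices: transpose) *)
Definition creat (R : realType) d L (m : Mode d L) : Op R d L := (annih R m)^T.

Definition numop (R : realType) d L (m : Mode d L) : Op R d L :=
  creat R m *m annih R m.

Definition Ne (R : realType) d L : Op R d L := \sum_(m : Mode d L) numop R m.

Definition aop (R : realType) d L (lam : R) (b : Bond d L) (s : bool) : Op R d L :=
  annih R (vsite (b.1), s) + annih R (vsite (shift b.1 b.2), s)
  + lam *: annih R (msite b, s).

Definition Hhop (R : realType) d L (t lam : R) : Op R d L :=
  \sum_(s : bool) \sum_(b : Bond d L) t *: ((aop lam b s)^T *m aop lam b s).

Definition Hint (R : realType) d L (U U' : R) : Op R d L :=
  U *: (\sum_(u : Vtx d L) numop R (vsite u, true) *m numop R (vsite u, false))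
  + U' *: (\sum_(b : Bond d L) numop R (msite b, true) *m numop R (msite b, false)).

Definition Ham (R : realType) d L (t lam U U' : R) : Op R d L :=
  Hhop d L t lam + Hint d L U U'.

Definition is_ground_proj (R : realType) d L (H P : Op R d L) : Prop :=
  P^T = P /\ P *m P = P /\
  (forall x : 'cV[R]_(fdim d L), H *m x = 0 <-> P *m x = x).

(* e^{mu N_e}: N_e is diagonal in the occupation basis with eigenvalue |S| *)
Definition expmuN (R : realType) d L (mu : R) : Op R d L :=
  diag_mx (\row_i expR (mu * (#|conf_of i|)%:R)).

Definition gc_avg (R : realType) d L (P : Op R d L) (mu : R) (O : Op R d L) : R :=
  \tr (O *m expmuN d L mu *m P) / \tr (expmuN d L mu *m P).

(* Main.v *)
(** [H] is a sum of positive terms, so [H x = 0] says that every [aop] and every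
    double occupancy annihilates [x]. The invertible operator
    [T = prod (1 - lam^-1 c^dag_m (c_v + c_w))], over the midpoint modes [m] of the
    bonds [{v, w}], turns [aop] into [lam c_m]. Hence [T^-1] maps the zero-energy
    space onto the states supported on spin configurations [V -> {empty, up, down}]
    whose amplitudes are unchanged when two neighbouring electrons exchange their
    spins, and [T] preserves the particle number. So [Tr [f(N_e) P_0]] is the sum of
    [f(number of electrons)] over the exchange classes of spin configurations; with
    [A] the set of occupied sites this is a site percolation model with weight
    [e^(mu |A|) prod_C (|C| + 1)], [C] running over the clusters of [A].

    Upper bound: adding an electron at an empty site at most doubles the number of
    classes. Lower bound: it exactly doubles it when no neighbour is occupied, so a
    site together with its at most [2d] neighbours carries on average at least
    [(1 + e^(-mu)/2)^-1] electrons, and [2d + 1 <= 3^d]. For [d >= 2], every cluster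
    but the largest satisfies [|C| + 1 <= 2^(d b)], [b] its number of boundary bonds,
    by isoperimetry; hence [prod_C (|C| + 1) <= (|V| + 1) K^k] with [k] the number of
    holes, while the full lattice alone contributes [|V| + 1] classes. The
    exponential moment [E e^k <= (1 + e K e^(-mu))^|V|] then bounds [E k]. *)
Require Import Defs.
From HB Require Import structures.
From mathcomp Require Import all_boot all_order all_fingroup all_algebra.
From mathcomp Require Import reals.
From mathcomp Require Import sequences exp.
From mathcomp Require Import ring lra zify.
Set Implicit Arguments. Unset Strict Implicit. Unset Printing Implicit Defensive.
Import Order.TTheory GRing.Theory Num.Theory.
Local Open Scope ring_scope.

(** * Enumeration of a product *)

Lemma index_enum_rank (T : finType) (x : T) : index x (enum T) = enum_rank x.
Proof. by rewrite -{1}(nth_enum_rank x x) index_uniq ?enum_uniq // -cardE. Qed.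

Lemma index_allpairs (T1 T2 : eqType) (s : seq T1) (t : seq T2) x y : x \in s -> y \in t ->
  index (x, y) [seq (a, b) | a <- s, b <- t] = (index x s * size t + index y t)%N.
Proof.
move=> + yt; elim: s => //= a s IHs; rewrite inE index_cat size_map.
have [->|ax] := eqVneq x a.
  rewrite map_f // index_map; last by move=> b b0 [].
  by [].
rewrite /= => xs; rewrite ifN ?IHs // ?mulSn ?addnA //.
by apply/mapP=> -[b _ [E _]]; rewrite E eqxx in ax.
Qed.

Lemma enum_rank_pair (T1 T2 : finType) (x : T1) (y : T2) :
  enum_rank (x, y) = (enum_rank x * #|T2| + enum_rank y)%N :> nat.
Proof.
rewrite -!index_enum_rank [enum {: T1 * T2}]enumT unlock /= /prod_enum index_allpairs ?mem_enum //.
by rewrite -cardE.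
Qed.

(** On modes [(site, spin)], the order of two modes at distinct sites ignores their spins; the
    Jordan-Wigner signs rely on this. *)
Lemma enum_rank_pair_lt (T1 T2 : finType) (x x' : T1) (y y' : T2) : x != x' ->
  (enum_rank (x, y) < enum_rank (x', y'))%N = (enum_rank x < enum_rank x')%N.
Proof.
move=> xx'; have : nat_of_ord (enum_rank x) != enum_rank x' by rewrite val_eqE (inj_eq enum_rank_inj).
rewrite !enum_rank_pair; have := ltn_ord (enum_rank y); have := ltn_ord (enum_rank y').
move: (nat_of_ord (enum_rank x)) (nat_of_ord (enum_rank x')) => a b.
by move: #|T2| (nat_of_ord (enum_rank y)) (nat_of_ord (enum_rank y')) => q u v *; nia.
Qed.

(** * Exchange classes of spin configurations on a graph *)

Lemma connect_ind (T : finType) (e : rel T) (Q : T -> Prop) (x y : T) :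
  (forall a b, Q a -> e a b -> Q b) -> connect e x y -> Q x -> Q y.
Proof.
move=> IH /connectP[p]; elim: p x => [|a p IHp] x /= => [_ -> //|/andP[xa pa] lp Qx].
exact: (IHp a pa lp (IH _ _ Qx xa)).
Qed.

Section SpinClasses.
Variables (V : finType) (adj : rel V).
Hypotheses (adjC : symmetric adj) (adjnn : irreflexive adj).

Definition spins := {ffun V -> option bool}.
Implicit Types (g h : spins) (x v w : V).

Definition occ g : {set V} := [set u | g u].
Definition upd g x (o : option bool) : spins := [ffun u => if u == x then o else g u].
Definition exch g v w : spins := [ffun u => g (tperm v w u)].
Definition swap : rel spins := fun g g' =>
  [exists v, exists w, [&& adj v w, v \in occ g, w \in occ g & g' == exch g v w]].

Lemma exchK v w : involutive (fun g => exch g v w).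
Proof. by move=> g; apply/ffunP=> u; rewrite !ffunE tpermK. Qed.

Lemma swapP g g' :
  reflect (exists v w, [/\ adj v w, v \in occ g, w \in occ g & g' = exch g v w]) (swap g g').
Proof.
apply: (iffP existsP) => [[v /existsP[w /and4P[? ? ? /eqP ?]]]|[v [w [? ? ? ->]]]].
  by exists v, w.
by exists v; apply/existsP; exists w; apply/and4P.
Qed.

Lemma occ_exch g v w : v \in occ g -> w \in occ g -> occ (exch g v w) = occ g.
Proof.
move=> vg wg; apply/setP=> u; rewrite !inE ffunE.
by case: tpermP => // ->; [move: vg wg|move: vg wg]; rewrite !inE => -> ->.
Qed.

Lemma occ_swap g g' : swap g g' -> occ g' = occ g.
Proof. by case/swapP=> v [w [_ vg wg ->]]; rewrite occ_exch. Qed.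

Lemma swap_sym : symmetric swap.
Proof.
suff imp g g' : swap g g' -> swap g' g by move=> g g'; apply/idP/idP; apply: imp.
case/swapP=> v [w [vw vg wg ->]]; apply/swapP; exists v, w.
by rewrite occ_exch // exchK.
Qed.

Lemma eqv_sym : connect_sym swap.
Proof. exact: (sym_connect_sym swap_sym). Qed.

Lemma occ_eqv g g' : connect swap g g' -> occ g' = occ g.
Proof.
move=> c; apply: (connect_ind (Q := fun h => occ h = occ g) _ c) => // a b <-.
exact: occ_swap.
Qed.

Definition ups g (C : {set V}) := #|[set u in C | g u == Some true]|.

Lemma ups_exch g v w (C : {set V}) :
  (v \in C) = (w \in C) -> ups (exch g v w) C = ups g C.
Proof.
move=> vw; rewrite /ups -(card_imset _ (@perm_inj _ (tperm v w))).
apply: eq_card => u; rewrite -{1}(tpermK v w u) (mem_imset _ _ (@perm_inj _ _)).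
by rewrite !inE ffunE tpermK; case: tpermP => // ->; rewrite vw.
Qed.

Lemma upd_exch h x v w o : v != x -> w != x ->
  upd (exch h v w) x o = exch (upd h x o) v w.
Proof.
move=> vx wx; apply/ffunP=> u; rewrite !ffunE.
by case: tpermP => [->|->|//]; rewrite (negPf vx) (negPf wx).
Qed.

Lemma upd_id h x : upd h x (h x) = h.
Proof. by apply/ffunP=> u; rewrite ffunE; case: eqP => // ->. Qed.

Lemma upd_upd h x o o' : upd (upd h x o) x o' = upd h x o'.
Proof. by apply/ffunP=> u; rewrite !ffunE; case: eqP. Qed.

Lemma updx h x o : upd h x o x = o.
Proof. by rewrite ffunE eqxx. Qed.

Lemma occ_upd h x s : occ (upd h x (Some s)) = x |: occ h.
Proof. by apply/setP=> u; rewrite !inE ffunE; case: eqP. Qed.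

(** An empty site takes part in no exchange, so the same path of exchanges stays valid after [x] is
    given the value [o]. *)
Lemma eqv_upd h h' x o : h x = None -> connect swap h h' ->
  connect swap (upd h x o) (upd h' x o).
Proof.
move=> hx c.
pose Q (g : spins) := connect swap (upd h x o) (upd g x o) /\ g x = None.
suff [] : Q h' by [].
apply: (connect_ind (Q := Q) _ c); rewrite /Q //.
move=> a b [ca ax] /swapP[v [w [vw va wa ->]]].
have vx : v != x by apply: contraTneq va => ->; rewrite inE ax.
have wx : w != x by apply: contraTneq wa => ->; rewrite inE ax.
split; last by rewrite ffunE tpermD // ax.
apply: (connect_trans ca); apply/connect1/swapP; exists v, w; rewrite -upd_exch //.
by split=> //; rewrite inE ffunE ?(negPf vx) ?(negPf wx); [move: va|move: wa]; rewrite inE.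
Qed.

(** An exchange moving [x] would need an occupied neighbour of [x], and the occupied set never
    changes: [x] is a spectator. *)
Lemma eqv_erase g g' x : x \in occ g -> (forall y, adj x y -> y \notin occ g) ->
  connect swap g g' -> g' x = g x /\ connect swap (upd g x None) (upd g' x None).
Proof.
move=> xg iso c.
pose Q (a : spins) := [/\ a x = g x, connect swap (upd g x None) (upd a x None) & occ a = occ g].
suff [] : Q g' by [].
apply: (connect_ind (Q := Q) _ c); rewrite /Q //.
move=> a b [ax ca oa] /swapP[v [w [vw va wa ->]]].
have vx : v != x by apply: contraTneq wa => vx; rewrite oa iso // -vx.
have wx : w != x by apply: contraTneq va => wx; rewrite oa iso // -wx adjC.
split; [by rewrite ffunE tpermD | | by rewrite occ_exch].
apply: (connect_trans ca); apply/connect1/swapP; exists v, w; rewrite -upd_exch //.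
by split=> //; rewrite inE ffunE ?(negPf vx) ?(negPf wx); [move: va|move: wa]; rewrite inE.
Qed.

(** * Class weights and density bounds by local moves *)

Section Weights.
Variable R : realType.

(* Each class has total weight 1: a sum of [omega] counts classes. *)
Definition omega g : R := #|connect swap g|%:R^-1.

Lemma card_class_gt0 g : (0 < #|connect swap g|)%N.
Proof. by apply/card_gt0P; exists g; rewrite inE. Qed.

Lemma omega_gt0 g : 0 < omega g.
Proof. by rewrite invr_gt0 ltr0n card_class_gt0. Qed.

Lemma omega_eqv g g' : connect swap g g' -> omega g' = omega g.
Proof.
move=> c; rewrite /omega; congr (_%:R^-1); apply: eq_card => h.
by rewrite !inE (same_connect eqv_sym c).
Qed.

Lemma sum_omega_class g : \sum_(h | connect swap g h) omega h = 1.
Proof.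
rewrite (eq_bigr (fun=> omega g)) => [|h /omega_eqv //].
rewrite sumr_const -[LHS]mulr_natl mulfV // pnatr_eq0 -lt0n; exact: card_class_gt0.
Qed.

Lemma sum_omega_le1 (Q : pred spins) :
  {in Q &, forall g h, connect swap g h} -> \sum_(g | Q g) omega g <= 1.
Proof.
move=> QQ; case: (pickP Q) => [g Qg|Q0]; last by rewrite big_pred0 // ler01.
rewrite -(sum_omega_class g) [leRHS](bigID Q) /=.
rewrite [X in _ <= X + _](eq_bigl Q) => [|h]; first last.
  by case Qh: (Q h); rewrite ?andbF // QQ.
by rewrite lerDl sumr_ge0 // => h _; apply/ltW/omega_gt0.
Qed.

(** Filling [x] injects the class of [h] into that of the filled configuration. *)
Lemma omega_upd_le h x s : h x = None -> omega (upd h x (Some s)) <= omega h.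
Proof.
move=> hx; rewrite /omega lef_pV2 ?posrE ?ltr0n ?card_class_gt0 // ler_nat.
have inj : {in connect swap h &, injective (fun g => upd g x (Some s))}.
  move=> a b; rewrite !inE => /occ_eqv oa /occ_eqv ob /(congr1 (fun g => upd g x None)).
  have nx c : occ c = occ h -> upd c x None = c.
    move=> oc; rewrite -[RHS](upd_id c x); congr upd.
    by move/setP/(_ x): oc; rewrite !inE hx; case: (c x).
  by rewrite !upd_upd !nx.
rewrite -(card_in_image inj); apply/subset_leq_card/subsetP=> _ /imageP[g c ->].
exact: eqv_upd.
Qed.

(** With no occupied neighbour, erasing [x] is an injection the other way. *)
Lemma omega_upd_ge h x s : h x = None -> (forall y, adj x y -> y \notin occ h) ->
  omega h <= omega (upd h x (Some s)).
Proof.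
move=> hx iso; rewrite /omega lef_pV2 ?posrE ?ltr0n ?card_class_gt0 // ler_nat.
set g0 := upd h x (Some s).
have er g : connect swap g0 g -> g x = Some s /\ connect swap h (upd g x None).
  move=> c; have [||-> c'] := eqv_erase (x := x) _ _ c.
  - by rewrite occ_upd setU11.
  - move=> y xy; rewrite occ_upd in_setU1 negb_or iso // andbT.
    by apply: contraTneq xy => ->; rewrite adjnn.
  by rewrite updx; split=> //; move: c'; rewrite upd_upd -[in upd h x None]hx upd_id.
have inj : {in connect swap g0 &, injective (fun g => upd g x None)}.
  move=> a b /er[ax _] /er[bx _] /(congr1 (fun g => upd g x (Some s))).
  by rewrite !upd_upd -{1}ax -bx !upd_id.
rewrite -(card_in_image inj); apply/subset_leq_card/subsetP=> _ /imageP[g c ->].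
by have [] := er _ c.
Qed.

Lemma sum_occupied x (F : spins -> R) :
  \sum_(g | x \in occ g) F g = \sum_(h | x \notin occ h) \sum_(s : bool) F (upd h x (Some s)).
Proof.
rewrite pair_big /=.
(* The default [true] is read only at an empty [x], which the condition on [g] excludes. *)
rewrite (reindex_onto (fun p : spins * bool => upd p.1 x (Some p.2))
          (fun g => (upd g x None, odflt true (g x)))) /=; last first.
  move=> g; rewrite inE; case gx: (g x) => [s|] //= _.
  by rewrite upd_upd -gx upd_id.
apply: eq_bigl => -[h s] /=; rewrite andbT upd_upd inE updx inE /=.
case hx: (h x) => [s'|] /=; last by rewrite -{1}hx upd_id eqxx.
by apply/negbTE; apply/eqP=> -[] /(congr1 (fun g : spins => g x)); rewrite updx hx.
Qed.

Variable z : R.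
Hypothesis z_gt0 : 0 < z.

(** With fugacity [z = expR mu], [Zsum] and [Nsum] become the traces of [e^(mu N_e) P_0] and
    [N_e e^(mu N_e) P_0]. *)
Definition wt g : R := z ^+ #|occ g| * omega g.
Definition Zsum : R := \sum_g wt g.
Definition Nsum : R := \sum_g #|occ g|%:R * wt g.

Lemma wt_gt0 g : 0 < wt g.
Proof. by rewrite mulr_gt0 ?exprn_gt0 // omega_gt0. Qed.

Lemma Zsum_gt0 : 0 < Zsum.
Proof.
rewrite /Zsum (bigD1 [ffun=> None]) //= ltr_pwDl ?wt_gt0 //.
by apply: sumr_ge0 => g _; apply/ltW/wt_gt0.
Qed.

Lemma Zsum_split (Q : pred spins) :
  Zsum = \sum_(g | Q g) wt g + \sum_(g | ~~ Q g) wt g.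
Proof. exact: bigID. Qed.

Lemma Nsum_sites : Nsum = \sum_x \sum_(g | x \in occ g) wt g.
Proof.
rewrite (exchange_big_dep xpredT) //=; apply: eq_bigr => g _.
by rewrite sumr_const mulr_natl.
Qed.

(** Mean occupation of a single site that is empty with weight 1 and carries either spin with weight
    [z]. *)
Definition rho : R := (1 + z^-1 / 2)^-1.

Lemma rhoE : rho = 2 * z / (1 + 2 * z).
Proof.
rewrite /rho; field.
by rewrite !gt_eqF // !addr_gt0 ?mulr_gt0.
Qed.

(** For each [x], filling an empty [x] with either spin costs a factor [z] and does not increase
    [omega]; so the occupied weight [p] is at most [2 z] times the empty one. *)
Lemma Nsum_le : Nsum <= rho * #|V|%:R * Zsum.
Proof.
rewrite Nsum_sites -mulrA mulrCA mulr_natl -sumr_const; apply: ler_sum => x _.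
set p := \sum_(g | _) _.
have le_pq : p <= 2 * z * \sum_(g | x \notin occ g) wt g.
  rewrite /p sum_occupied mulr_sumr; apply: ler_sum => h xh.
  rewrite -[2]/(1 + 1) !mulrDl mul1r big_bool /=.
  have hx : h x = None by move: xh; rewrite inE; case: (h x).
  by apply: lerD; rewrite /wt occ_upd cardsU1 xh exprS -mulrA ler_pM2l // ler_pM2l
     ?exprn_gt0 // omega_upd_le.
have := Zsum_split (fun g => x \in occ g); rewrite -/p => ZE.
rewrite rhoE mulrAC ler_pdivlMr; last by rewrite addr_gt0 ?mulr_gt0.
rewrite ZE; lra.
Qed.

Variable D : nat.
Hypothesis degP : forall x, (#|[set y | adj x y]| <= D)%N.

(** Each closed neighbourhood [nb x] holds on average at least [rho] electrons; summing over [x]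
    counts an electron at most [D.+1] times. *)
Lemma Nsum_ge : rho * #|V|%:R * Zsum <= D.+1%:R * Nsum.
Proof.
pose nb x := x |: [set y | adj x y].
have -> : rho * #|V|%:R * Zsum = \sum_(x : V) rho * Zsum.
  by rewrite sumr_const -mulrA mulrCA mulr_natl.
have step x : rho * Zsum <= \sum_g #|occ g :&: nb x|%:R * wt g.
  rewrite (bigID (fun g => [disjoint occ g & nb x])) /=.
  rewrite big1 ?add0r; last first.
    by move=> g dj; move: dj; rewrite -setI_eq0 => /eqP ->; rewrite cards0 mul0r.
  have := Zsum_split (fun g => [disjoint occ g & nb x]).
  set e0 := \sum_(g | _) _; set e1 := \sum_(g | _) _ => ZE.
  (* When [nb x] is empty, filling [x] does not decrease [omega], and the result meets [nb x]. *)
  have e01 : 2 * z * e0 <= e1.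
    rewrite /e1 (bigID (fun g => x \in occ g)) /=.
    rewrite [X in _ <= X + _](eq_bigl (fun g => x \in occ g)); last first.
      move=> g; rewrite andbC; case xg: (x \in occ g) => //=.
      by apply/pred0Pn; exists x; rewrite /= xg setU11.
    apply: (@le_trans _ _ (\sum_(g | x \in occ g) wt g)); last first.
      by rewrite lerDl sumr_ge0 // => g _; apply/ltW/wt_gt0.
    rewrite sum_occupied [leRHS](bigID (fun h => [disjoint occ h & nb x])) /=.
    apply: (@le_trans _ _ (\sum_(h | (x \notin occ h) && [disjoint occ h & nb x])
         \sum_(s : bool) wt (upd h x (Some s)))); last first.
      by rewrite lerDl sumr_ge0 // => g _; rewrite sumr_ge0 // => s _; apply/ltW/wt_gt0.
    rewrite (eq_bigl (fun h => [disjoint occ h & nb x])); last first.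
      move=> h; rewrite andbC; case dj: [disjoint _ & _] => //=.
      by rewrite (disjointFl dj) // setU11.
    rewrite /e0 mulr_sumr; apply: ler_sum => h dj.
    have xh : x \notin occ h by rewrite (disjointFl dj) // setU11.
    have hx : h x = None by move: xh; rewrite inE; case: (h x).
    have iso y : adj x y -> y \notin occ h.
      by move=> xy; rewrite (disjointFl dj) // !inE xy orbT.
    rewrite -[2]/(1 + 1) !mulrDl mul1r big_bool /=.
    by apply: lerD; rewrite /wt occ_upd cardsU1 xh exprS -mulrA ler_pM2l // ler_pM2l
      ?exprn_gt0 // omega_upd_ge.
  apply: (@le_trans _ _ e1).
    rewrite rhoE mulrAC ler_pdivrMr ?ZE; last by rewrite addr_gt0 ?mulr_gt0.
    lra.
  apply: ler_sum => g dj; rewrite ler_peMl ?(ltW (wt_gt0 _)) // ler1n card_gt0.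
  by rewrite setI_eq0.
apply: (le_trans (ler_sum _ (fun x _ => step x))).
rewrite exchange_big /= /Nsum mulr_sumr; apply: ler_sum => g _.
rewrite -mulr_suml mulrA ler_pM2r ?wt_gt0 // -natr_sum -natrM ler_nat.
rewrite (eq_bigr (fun x => \sum_(y in occ g) (y \in nb x)%N)%N); last first.
  move=> x _; rewrite -sum1_card big_mkcond [RHS]big_mkcond /=; apply: eq_bigr => y _.
  by rewrite inE; case: (y \in occ g); case: (y \in nb x).
rewrite exchange_big /= mulnC -sum_nat_const; apply: leq_sum => y _.
rewrite (eq_bigr (fun x => if x \in nb y then 1 else 0)%N); last first.
  by move=> x _; rewrite !inE adjC eq_sym; case: (_ || _).
rewrite -big_mkcond sum1_card cardsU1; exact: (leq_add (leq_b1 _) (degP y)).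
Qed.

End Weights.
End SpinClasses.

(** * Clusters and the number of classes *)

Section Clusters.
Variables (V : finType) (adj : rel V).
Hypothesis adjC : symmetric adj.
Implicit Types (g h : spins V) (x v w r : V) (A C : {set V}).

Definition bond_in A : rel V := fun v w => [&& adj v w, v \in A & w \in A].
Definition cluster A r : {set V} := [set w | connect (bond_in A) r w].
(** One canonical root per cluster. A site outside [A] is its own root, hence the test [r \in A]. *)
Definition reps A : pred V := fun r => (r \in A) && (fingraph.root (bond_in A) r == r).

Lemma bond_in_sym A : connect_sym (bond_in A).
Proof. by apply: sym_connect_sym => v w; rewrite /bond_in adjC (andbC (v \in A)). Qed.

Lemma cluster_root A r : cluster A (fingraph.root (bond_in A) r) = cluster A r.
Proof.
apply/setP=> w; rewrite !inE.
by rewrite (same_connect (bond_in_sym A) (connect_root _ r)).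
Qed.

Lemma connect_in A v w : connect (bond_in A) v w -> v \in A -> w \in A.
Proof.
by move=> c; apply: (connect_ind (Q := fun u => u \in A) _ c) => a b _ /and3P[].
Qed.

Lemma root_in A v : (fingraph.root (bond_in A) v \in A) = (v \in A).
Proof.
apply/idP/idP; apply: connect_in; last exact: connect_root.
by rewrite bond_in_sym connect_root.
Qed.

(** Exchanges of neighbours along a path generate every transposition inside a cluster. *)
Lemma eqv_exch A g v w : connect (bond_in A) v w -> occ g = A ->
  connect (swap adj) g (exch g v w).
Proof.
move=> c; move: g; pose Q w := forall g, occ g = A -> connect (swap adj) g (exch g v w).
apply: (connect_ind (Q := Q) _ c); last first.
  by move=> g _; have -> : exch g v v = g by apply/ffunP=> u; rewrite ffunE tperm1 perm1.
move=> a b Qa /and3P[ab aA bA] g og.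
have sw h : occ h = A -> connect (swap adj) h (exch h a b).
  by move=> oh; apply/connect1/swapP; exists a, b; rewrite oh.
have [<-|va] := eqVneq a v; first exact: sw.
have [->|vb] := eqVneq b v.
  by have -> : exch g v v = g by apply/ffunP=> u; rewrite ffunE tperm1 perm1.
(* (v b) is the conjugate of (v a) by (a b) *)
have -> : exch g v b = exch (exch (exch g a b) v a) a b.
  apply/ffunP=> u; rewrite !ffunE; congr (g _).
  have -> : tperm v b = ((tperm v a) ^ (tperm a b))%g by rewrite tpermJ tpermL tpermD.
  by rewrite conjgE tpermV !permM.
have o1 : occ (exch g a b) = A by rewrite occ_exch ?og.
have c2 := Qa _ o1.
apply: (connect_trans (sw _ og)); apply: (connect_trans c2); apply: sw.
by rewrite (occ_eqv c2).
Qed.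

(** Sites of [C] that are up only in [g] are as many as those up only in [h], so a wrong spin at [v]
    is matched by an opposite one elsewhere. *)
Lemma ups_mismatch g h C v : occ g = occ h -> ups g C = ups h C ->
  v \in C -> g v != h v -> exists2 w, w \in C & g w = h v /\ h w = g v.
Proof.
move=> ogh; rewrite /ups; set X := [set u in _ | _]; set Y := [set u in _ | _] => XY vC gh.
have oE u : isSome (g u) = isSome (h u) by move/setP/(_ u): ogh; rewrite !inE.
have XYd : #|X :\: Y| = #|Y :\: X|.
  by have := cardsID Y X; have := cardsID X Y; rewrite setIC XY; lia.
have [s gv] : exists s, g v = Some s.
  by move: gh (oE v); case: (g v) => [s|]; [exists s|case: (h v)].
have hv : h v = Some (~~ s).
  by move: gh (oE v); rewrite gv; case: (h v) s {gv} => [[]|] // [].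
case: s gv hv => gv hv.
  have : (0 < #|Y :\: X|)%N.
    by rewrite -XYd; apply/card_gt0P; exists v; rewrite !inE vC gv hv.
  case/card_gt0P=> w; rewrite !inE => /andP[+ /andP[wC /eqP hw]].
  rewrite wC => /= gw; exists w => //; rewrite hv gv hw.
  by move: (oE w) gw; rewrite hw; case: (g w) => [[]|].
have : (0 < #|X :\: Y|)%N.
  by rewrite XYd; apply/card_gt0P; exists v; rewrite !inE vC gv hv.
case/card_gt0P=> w; rewrite !inE => /andP[+ /andP[wC /eqP gw]].
rewrite wC => /= hw; exists w => //; rewrite hv gv gw.
by move: (oE w) hw; rewrite gw; case: (h w) => [[]|].
Qed.

(** Exchanging a wrong spin with an opposite one in its cluster repairs both sites: induction on the
    number of disagreements. *)
Lemma eqv_of_ups A g h : occ g = A -> occ h = A ->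
  {in A, forall r, ups g (cluster A r) = ups h (cluster A r)} -> connect (swap adj) g h.
Proof.
move=> + oh; have [n] := ubnP #|[set u | g u != h u]|.
elim: n g => // n IHn g; rewrite ltnS => le_n og uE.
have [d0|] := set_0Vmem [set u | g u != h u].
  have -> : g = h by apply/ffunP=> u; move/setP/(_ u): d0; rewrite !inE => /negbFE/eqP.
  exact: connect0.
case=> v; rewrite inE => vD.
have vA : v \in A.
  apply: contraNT vD => vA.
  have /= := vA; rewrite -{1}og inE; have /= := vA; rewrite -{1}oh inE.
  by case: (g v); case: (h v).
have vC : v \in cluster A v by rewrite inE connect0.
have [w wC [gw hw]] := ups_mismatch (etrans og (esym oh)) (uE v vA) vC vD.
have cvw : connect (bond_in A) v w by move: wC; rewrite inE.
have c1 := eqv_exch cvw og.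
apply: (connect_trans c1); apply: IHn; last first.
- move=> r rA; rewrite -uE // ups_exch // !inE.
  by rewrite !(bond_in_sym A r) (same_connect (bond_in_sym A) cvw).
- by rewrite (occ_eqv c1).
apply: leq_trans le_n; apply/proper_card/properP; split.
  apply/subsetP=> u; rewrite !inE ffunE; case: tpermP => [->|->|//].
    by rewrite gw eqxx.
  by rewrite hw eqxx.
by exists v; rewrite !inE // ffunE tpermL gw eqxx.
Qed.

Lemma ups_le g C : (ups g C <= #|C|)%N.
Proof. by apply/subset_leq_card/subsetP=> u; rewrite inE => /andP[]. Qed.

(** * Counting classes and the exponential moment of the number of holes *)

Section Entropy.
Variable R : realType.

(** The number of exchange classes with occupied set [A]: [occ] is constant on a class, and a class
    has total weight 1. *)
Definition kappa A : R := \sum_(g | occ g == A) omega adj R g.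

(** By [eqv_of_ups], configurations with the same vector of up counts lie in one class, so it
    suffices to count vectors. *)
Lemma kappa_le_clusters A : kappa A <= (\prod_(r | reps A r) #|cluster A r|.+1)%:R.
Proof.
(* Coordinates that index no cluster are frozen at [ord0] and contribute a factor 1. *)
pose F r : pred 'I_(#|V|.+1) :=
  fun i => if reps A r then (i < #|cluster A r|.+1)%N else i == ord0.
pose I g : {ffun V -> 'I_(#|V|.+1)} :=
  [ffun r => if reps A r then inord (ups g (cluster A r)) else ord0].
have upsV g r : (ups g (cluster A r) < #|V|.+1)%N.
  by rewrite ltnS (leq_trans (ups_le _ _)) // max_card.
rewrite /kappa (partition_big I (fun f => f \in family F)) /=; last first.
  move=> g _; apply/familyP=> r; rewrite ffunE /F unfold_in.
  by case: (reps A r) => //=; rewrite inordK // ltnS ups_le.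
apply: (@le_trans _ _ (\sum_(f in family F) 1)).
  apply: ler_sum => f _; apply: sum_omega_le1 => // g h.
  rewrite !unfold_in => /andP[/eqP og /eqP Ig] /andP[/eqP oh /eqP Ih].
  apply: (eqv_of_ups og oh) => r rA; rewrite -cluster_root.
  have rr : reps A (fingraph.root (bond_in A) r).
    by rewrite /reps root_in rA (root_root (bond_in_sym A)) eqxx.
  have /ffunP/(_ (fingraph.root (bond_in A) r)) := etrans Ig (esym Ih).
  by rewrite !ffunE rr => /(congr1 val); rewrite /= !inordK.
rewrite sumr_const ler_nat card_family.
have -> : foldr muln 1%N [seq #|F x| | x : V] = (\prod_x #|F x|)%N.
  by rewrite foldrE big_map enumT.
rewrite [X in (_ <= X)%N]big_mkcond /=; apply: leq_prod => r _.
rewrite /F; case: ifP => _; last by rewrite card1.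
rewrite -[X in (X <= _)%N]sum1_card (eq_bigl (fun i : 'I_(#|V|.+1) => (i < #|cluster A r|.+1)%N)) //.
by rewrite -(@big_ord_widen _ _ _ _ #|V|.+1 (fun=> 1%N)) ?sum1_card ?card_ord // ltnS max_card.
Qed.

(** The total number of up spins is invariant under exchange and takes every value from 0 to
    [#|V|]. *)
Lemma kappa_full : #|V|.+1%:R <= kappa setT.
Proof.
pose u g : 'I_(#|V|.+1) := inord (ups g setT).
have uV g : (ups g setT < #|V|.+1)%N by rewrite ltnS (leq_trans (ups_le _ _)) // max_card.
rewrite /kappa (partition_big u xpredT) //=.
have -> : #|V|.+1%:R = \sum_(i < #|V|.+1) 1 :> R by rewrite sumr_const card_ord.
apply: ler_sum => i _.
(* The first [i] sites are up, the others down; the whole class of [g0] lies in the fibre of [i]. *)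
pose g0 : spins V := [ffun v => Some (enum_rank v < i)%N].
have ug0 : ups g0 setT = i.
  rewrite /ups -sum1_card (eq_bigl (fun v => (enum_rank v < i)%N)); last first.
    by move=> v; rewrite !inE ffunE; case: (_ < _)%N.
  rewrite (reindex (@enum_val V predT)) /=; last first.
    by exists enum_rank => x _; [apply: enum_valK|apply: enum_rankK].
  under eq_bigl do rewrite enum_valK.
  rewrite -(@big_ord_widen _ _ _ _ #|V| (fun=> 1%N)) ?sum1_card ?card_ord //.
  by rewrite -ltnS ltn_ord.
rewrite -(sum_omega_class adj _ g0) [leRHS](bigID (connect (swap adj) g0)) /=.
rewrite [X in _ <= X + _](eq_bigl (connect (swap adj) g0)); last first.
  move=> h; rewrite andbC; case c: (connect _ _ _) => //=.
  have -> : occ h == setT.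
    rewrite (occ_eqv c); apply/eqP/setP=> v; by rewrite !inE ffunE.
  rewrite /u; apply/eqP/val_inj; rewrite /= inordK // -[RHS]ug0.
  pose Q (h : spins V) := ups h setT = ups g0 setT.
  apply: (connect_ind (Q := Q) _ c); rewrite /Q // => a b <- /swapP[v [w [_ _ _ ->]]].
  by rewrite ups_exch // !inE.
by rewrite lerDl sumr_ge0 // => h _; apply/ltW/omega_gt0.
Qed.

Definition bdry C : {set V * V} := [set p | [&& p.1 \in C, p.2 \notin C & adj p.1 p.2]].

Variables (c D : nat).
Hypothesis degP : forall x, (#|[set y | adj x y]| <= D)%N.
Hypothesis isoP : forall C, (2 * #|C| <= #|V|)%N -> (#|C|.+1 <= 2 ^ (c * #|bdry C|))%N.

(** Sort the boundary pairs by outer endpoint, a hole with at most [D] neighbours. *)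
Lemma card_bdry A : (#|bdry A| <= #|~: A| * D)%N.
Proof.
have -> : (#|~: A| * D = \sum_(w in ~: A) D)%N by rewrite sum_nat_const.
rewrite -sum1_card (partition_big snd (fun w => w \in ~: A)) /=; last first.
  by move=> p; rewrite !inE => /and3P[].
apply: leq_sum => w _; apply: leq_trans (degP w).
rewrite sum1_card -[X in (_ <= X)%N](card_imset _ (f := fun v => (v, w))); last by move=> a b [].
apply/subset_leq_card/subsetP=> -[a b]; rewrite unfold_in inE /=.
move=> /andP[/and3P[_ _ ab] /eqP bw]; apply/imsetP; exists a; rewrite ?bw //.
by rewrite inE adjC -bw.
Qed.

(** A pair leaving a cluster leaves [A], and the root of its inner end recovers the cluster: no pair
    is counted twice. *)
Lemma sum_bdry_clusters A : (\sum_(r | reps A r) #|bdry (cluster A r)| <= #|bdry A|)%N.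
Proof.
rewrite -[X in (_ <= X)%N]sum1_card (partition_big (fun p => fingraph.root (bond_in A) p.1) (reps A)) /=.
  apply: leq_sum => r /andP[rA /eqP rr]; rewrite sum1_card.
  apply/subset_leq_card/subsetP=> -[v w]; rewrite inE /= => /and3P[+ + vw]; rewrite !inE => rv rw.
  apply/andP; rewrite inE /=.
  have vA := connect_in rv rA.
  split; last by rewrite -[X in _ == X]rr (root_connect (bond_in_sym A)) bond_in_sym.
  rewrite vA vw andbT /=.
  apply: contra rw => wA; apply: (connect_trans rv); apply: connect1.
  by rewrite /bond_in vw vA.
move=> p; rewrite inE /reps => /and3P[pA _ _].
by rewrite root_in pA (root_root (bond_in_sym A)) eqxx.
Qed.

(** The largest cluster gives the factor [#|V|.+1]. Any other is disjoint from it and no larger,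
    hence fills at most half of [V] and obeys [isoP]. *)
Lemma prod_clusters A :
  (\prod_(r | reps A r) #|cluster A r|.+1 <= #|V|.+1 * 2 ^ (c * (#|~: A| * D)))%N.
Proof.
case: (pickP (reps A)) => [r0 rr0|r00]; last first.
  by rewrite big_pred0 // muln_gt0 /= expn_gt0.
pose m := [arg max_(r > r0 | reps A r) #|cluster A r|].
have [rm maxm] : reps A m /\ forall r, reps A r -> (#|cluster A r| <= #|cluster A m|)%N.
  by rewrite /m; case: arg_maxnP.
rewrite (bigD1 m) //=; apply: leq_mul; first by rewrite ltnS max_card.
apply: (@leq_trans (\prod_(r | reps A r && (r != m)) 2 ^ (c * #|bdry (cluster A r)|))%N).
  apply: leq_prod => r /andP[rr rm']; apply: isoP.
  have dj : [disjoint cluster A r & cluster A m].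
    apply/pred0P=> w /=; apply/negP; rewrite !inE => /andP[rw mw].
    case/andP: rr rm' => _ /eqP <-; case/andP: rm => _ /eqP {1}<-.
    rewrite (root_connect (bond_in_sym A)).
    by rewrite (connect_trans rw) // bond_in_sym.
  have := max_card (mem (cluster A r :|: cluster A m)).
  by rewrite cardsU (disjoint_setI0 dj) cards0 subn0; have := maxm r rr; lia.
rewrite -expn_sum leq_exp2l // -big_distrr /= leq_mul //.
apply: leq_trans (card_bdry A); apply: leq_trans (sum_bdry_clusters A).
by rewrite [X in (_ <= X)%N](bigD1 m) //= leq_addl.
Qed.

Lemma kappa_le A : kappa A <= #|V|.+1%:R * (2 ^ (c * D))%:R ^+ #|~: A|.
Proof.
apply: (le_trans (kappa_le_clusters A)); rewrite -natrX -natrM ler_nat.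
by apply: (leq_trans (prod_clusters A)); rewrite -expnM mulnAC mulnA.
Qed.

Variable z : R.
Hypothesis z_gt0 : 0 < z.

Lemma sum_subsets (x y : R) : \sum_(A : {set V}) x ^+ #|A| * y ^+ #|~: A| = (x + y) ^+ #|V|.
Proof.
have -> : (x + y) ^+ #|V| = \prod_(v : V) (x + y) by rewrite prodr_const.
rewrite bigA_distr; apply: eq_bigr => A _.
rewrite [RHS](bigID (fun v => v \in A)) /=.
rewrite (eq_bigr (fun=> x)) => [|v -> //]; rewrite prodr_const; congr (_ * _).
rewrite (eq_bigr (fun=> y)) => [|v /negPf -> //]; rewrite prodr_const.
by congr (_ ^+ _); apply: eq_card => v; rewrite inE.
Qed.

(** The mean of [e^k], [k] the number of holes, is at most [e^a]: the prefactor [#|V|.+1] from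
    [kappa_le] cancels against the full lattice, the only part of [Zsum] kept. *)
Lemma holes_le (a := expR 1 * (2 ^ (c * D))%:R * #|V|%:R / z) :
  #|V|%:R * Zsum adj z - Nsum adj z <= a * Zsum adj z.
Proof.
set K : R := (2 ^ (c * D))%:R in a *.
have e0 : 0 < expR 1 :> R := expR_gt0 _.
have -> : #|V|%:R * Zsum adj z - Nsum adj z = \sum_g #|~: occ g|%:R * wt adj z g.
  rewrite /Zsum /Nsum mulr_sumr -sumrB; apply: eq_bigr => g _.
  by rewrite -mulrBl -(cardsC (occ g)) natrD addrAC subrr add0r.
have Ee : \sum_g expR 1 ^+ #|~: occ g| * wt adj z g <= expR a * Zsum adj z.
  apply: (@le_trans _ _ (#|V|.+1%:R * (z + expR 1 * K) ^+ #|V|)).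
    rewrite -sum_subsets mulr_sumr (partition_big (fun g => occ g) xpredT) //=.
    apply: ler_sum => A _.
    rewrite (eq_bigr (fun g => z ^+ #|A| * expR 1 ^+ #|~: A| * omega adj R g)); last first.
      by move=> g /eqP <-; rewrite /wt mulrCA mulrA.
    rewrite -mulr_sumr exprMn.
    rewrite [leRHS](_ : _ = z ^+ #|A| * expR 1 ^+ #|~: A| * (#|V|.+1%:R * K ^+ #|~: A|)).
      by rewrite ler_pM2l ?mulr_gt0 ?exprn_gt0 // kappa_le.
    ring.
  apply: (@le_trans _ _ (expR a * (#|V|.+1%:R * z ^+ #|V|))).
    (* [(1 + x)^n <= e^(n x)] with [x = e K / z] and [n = #|V|], so that [a = n x]. *)
    have -> : z + expR 1 * K = (1 + expR 1 * K / z) * z by field; rewrite gt_eqF.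
    rewrite [leRHS]mulrCA ler_pM2l // exprMn ler_pM2r ?exprn_gt0 //.
    rewrite [a](_ : _ = #|V|%:R * (expR 1 * K / z)); last by rewrite /a; ring.
    rewrite expRM_natl lerXn2r ?nnegrE ?expR_ge0 ?expR_ge1Dx //.
    by rewrite addr_ge0 // divr_ge0 ?mulr_ge0 // ltW.
  rewrite ler_pM2l ?expR_gt0 // mulrC.
  apply: (@le_trans _ _ (z ^+ #|V| * kappa setT)).
    by rewrite ler_pM2l ?exprn_gt0 // kappa_full.
  rewrite /kappa mulr_sumr /Zsum [leRHS](bigID (fun g => occ g == setT)) /=.
  rewrite -[leLHS]addr0; apply: lerD.
    by apply: ler_sum => g /eqP og; rewrite /wt og cardsT.
  by apply: sumr_ge0 => g _; apply/ltW/wt_gt0.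
(* [k <= (a - 1) + e^(k - a)] pointwise, with [k] the number of holes *)
apply: (@le_trans _ _ (\sum_g ((a - 1) * wt adj z g
    + expR (- a) * (expR 1 ^+ #|~: occ g| * wt adj z g)))).
  apply: ler_sum => g _; rewrite mulrA -mulrDl ler_pM2r ?wt_gt0 //.
  rewrite -expRM_natl mulr1 -expRD.
  have := expR_ge1Dx (- a + #|~: occ g|%:R); lra.
rewrite big_split /= -!mulr_sumr -/(Zsum adj z).
have := Ee; rewrite -(ler_pM2l (expR_gt0 (- a))) mulrA -expRD addNr expR0 mul1r.
lra.
Qed.

End Entropy.
End Clusters.

(** * Isoperimetry on the torus *)

Section Torus.
Variables (d L : nat).
Hypothesis L_gt1 : (1 < L)%N.
Local Notation V := (Vtx d L).
Implicit Types (u v w : V) (j k : 'I_d) (C : {set V}).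

Definition nbr : rel V := fun v w => [exists k, (w == shift v k) || (v == shift w k)].

Lemma nbr_sym : symmetric nbr.
Proof. by move=> v w; apply: eq_existsb => k; rewrite orbC. Qed.

Lemma shift_neq v k : shift v k != v.
Proof.
apply/eqP=> /ffunP/(_ k); rewrite ffunE eqxx => /(congr1 val) /=.
have := ltn_ord (v k); case: (ltngtP (v k).+1 L) => // [lt|eq] _.
  by rewrite modn_small //; lia.
by rewrite eq modnn; lia.
Qed.

Lemma nbrnn : irreflexive nbr.
Proof.
by move=> v; apply/existsP=> -[k]; rewrite eq_sym orbb (negPf (shift_neq v k)).
Qed.

Lemma nbr_shift v k : nbr v (shift v k).
Proof. by apply/existsP; exists k; rewrite eqxx. Qed.

Definition unshift v k : V := [ffun j => if j == k then ord_pred (v j) else v j].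

Lemma shiftK v k : unshift (shift v k) k = v.
Proof. by apply/ffunP=> j; rewrite !ffunE; case: eqP => // _; rewrite ordSK. Qed.

Lemma deg_nbr v : (#|[set w | nbr v w]| <= d + d)%N.
Proof.
apply: (@leq_trans #|[set shift v k | k : 'I_d] :|: [set unshift v k | k : 'I_d]|).
  apply/subset_leq_card/subsetP=> w; rewrite !inE => /existsP[k].
  case/orP=> /eqP ->; first by rewrite imset_f.
  by apply/orP; right; apply/imsetP; exists k; rewrite // shiftK.
by rewrite cardsU (leq_trans (leq_subr _ _)) // leq_add // (leq_trans (leq_imset_card _ _)) ?card_ord.
Qed.

Definition setc v k (a : 'I_L) : V := [ffun j => if j == k then a else v j].

Lemma iter_shift n v k j :
  val (iter n (fun u => shift u k) v j) = (if j == k then (v k + n) %% L else v j)%N.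
Proof.
elim: n => [|n IHn] /=; first by case: eqP => // ->; rewrite addn0 modn_small.
rewrite ffunE; case: eqP IHn => //= _ ->.
by rewrite -addn1 modnDml addn1 addnS.
Qed.

(** [L - v k] steps wrap round to coordinate 0 and [a] more reach [a], whichever of [v k] and [a] is
    larger. *)
Lemma iter_setc v k (a : 'I_L) : iter (L - v k + a) (fun u => shift u k) v = setc v k a.
Proof.
apply/ffunP=> j; apply: val_inj; rewrite iter_shift ffunE; case: eqP => // _.
by rewrite addnA subnKC 1?ltnW // modnDl modn_small.
Qed.

(** Shifts in direction [k] lead from [v] to [setc v k a]; at some step membership in [C]
    changes. *)
Lemma bdry_on_line C v k a : (v \in C) != (setc v k a \in C) ->
  exists2 p, p \in bdry nbr C & forall j, j != k -> p.1 j = v j.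
Proof.
rewrite -iter_setc; elim: (_ + _)%N => [|n IHn] /=; first by rewrite eqxx.
set u := iter n _ v in IHn *; have [->|/IHn //] := eqVneq (v \in C) (u \in C).
have uv j : j != k -> u j = v j.
  by move=> jk; apply: val_inj; rewrite iter_shift (negPf jk).
case uC: (u \in C); case sC: (shift u k \in C) => // _.
  by exists (u, shift u k) => //=; rewrite inE uC sC nbr_shift.
exists (shift u k, u) => /= [|j jk]; first by rewrite inE uC sC nbr_sym nbr_shift.
by rewrite ffunE (negPf jk) uv.
Qed.

(** Pass from [v] to [w] by changing one coordinate other than [k] at a time; a change of membership
    would put a boundary bond in the slice. *)
Lemma bdry_free_slice C k (i : 'I_L) v w : i \notin [set p.1 k | p : V * V in bdry nbr C] ->
  v k = i -> w k = i -> (v \in C) = (w \in C).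
Proof.
move=> iE vi wi.
pose mix (s : seq 'I_d) : V := [ffun j => if j \in s then w j else v j].
have mixP s : k \notin s -> (v \in C) = (mix s \in C).
  elim: s => [_|j s IHs].
    by congr (_ \in C); apply/ffunP=> j; rewrite ffunE.
  rewrite inE negb_or => /andP[kj ks]; rewrite (IHs ks).
  have -> : mix (j :: s) = setc (mix s) j (w j).
    by apply/ffunP=> l; rewrite !ffunE inE; case: (l =P j) => [->|].
  apply/eqP/negPn/negP=> /bdry_on_line[p pE pj]; case/negP: iE.
  by apply/imsetP; exists p => //; rewrite pj // ffunE (negPf ks).
rewrite (mixP [seq j <- enum 'I_d | j != k]); last by rewrite mem_filter eqxx.
congr (_ \in C); apply/ffunP=> j; rewrite ffunE mem_filter mem_enum andbT.
by case: eqP => //= ->; rewrite vi wi.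
Qed.

Lemma card_torus : #|{: V}| = (L ^ d)%N.
Proof. by rewrite card_ffun !card_ord. Qed.

(* If [b >= L] the bound is trivial. Otherwise, in each of two directions some slice
   carries no boundary bond, so [C] is constant on it, with the same value on both
   since they meet. A point where [C] takes the other value has a boundary bond on
   its line in either direction, and these two bonds determine the point. *)
Lemma weak_isoperimetry C : (1 < d)%N -> (2 * #|C| <= #|{: V}|)%N ->
  (#|C| <= #|bdry nbr C| ^ d)%N.
Proof.
move=> d_gt1 halfC; set b := #|bdry nbr C|.
have [Lb|bL] := leqP L b.
  by rewrite (leq_trans (max_card _)) // card_torus leq_exp2r // ltnW.
have freeP k : exists i : 'I_L, i \notin [set p.1 k | p : V * V in bdry nbr C].
  apply/existsP; apply: contraLR bL; rewrite negb_exists => /forallP al.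
  rewrite -leqNgt -[L in (L <= _)%N]card_ord; apply: leq_trans (leq_imset_card _ _).
  by apply/subset_leq_card/subsetP=> i _; have := al i; rewrite negbK; apply.
pose k0 : 'I_d := Ordinal (ltnW d_gt1); pose k1 : 'I_d := Ordinal d_gt1.
have [[i0 free0] [i1 free1]] := (freeP k0, freeP k1).
pose o : V := [ffun j => if j == k0 then i0 else i1].
pose X := [set v | (v \in C) != (o \in C)].
have Xb : (#|X| <= b * b)%N.
  pose psi (pq : (V * V) * (V * V)) : V :=
    [ffun j => if j == k0 then pq.2.1 k0 else pq.1.1 j].
  rewrite -cardsX; apply: leq_trans (leq_imset_card psi _).
  apply/subset_leq_card/subsetP=> v; rewrite inE => vX.
  have [|p pE pv] := @bdry_on_line C v k0 i0.
    by rewrite (bdry_free_slice (v := setc v k0 i0) (w := o) free0) ?ffunE ?eqxx.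
  have [|q qE qv] := @bdry_on_line C v k1 i1.
    by rewrite (bdry_free_slice (v := setc v k1 i1) (w := o) free1) ?ffunE ?eqxx.
  apply/imsetP; exists (p, q); first by rewrite inE pE.
  by apply/ffunP=> j; rewrite ffunE /=; case: eqP => [->|/eqP/pv //]; rewrite qv.
(* If [o] lies in [C], then [X] is the complement of [C], at least as large as [C] by [halfC]. *)
have CX : (#|C| <= #|X|)%N.
  case oC: (o \in C).
    have -> : X = ~: C by apply/setP=> v; rewrite !inE oC; case: (v \in C).
    by rewrite -(leq_add2l #|C|) addnn -mul2n cardsC.
  by apply/subset_leq_card/subsetP=> v vC; rewrite inE vC oC.
apply: (leq_trans CX); apply: (leq_trans Xb); rewrite mulnn.
by have [->|b0] := posnP b; [rewrite exp0n | rewrite leq_pexp2l].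
Qed.

Lemma isoperimetry C : (1 < d)%N -> (2 * #|C| <= #|{: V}|)%N ->
  (#|C|.+1 <= 2 ^ (d * #|bdry nbr C|))%N.
Proof.
move=> d1 /(weak_isoperimetry d1) Cb; set b := #|bdry _ _| in Cb *.
apply: (@leq_ltn_trans (b ^ d)%N) => //; rewrite mulnC expnM ltn_exp2r ?(ltnW d1) //.
exact: ltn_expl.
Qed.

End Torus.

(** * Fock space *)

Section Fock.
Variables (R : realType) (d L : nat).
Local Notation Op := (Op R d L).
Local Notation vec := ('cV[R]_(fdim d L)).
Local Notation c := (@annih R d L).
Local Notation c' := (@creat R d L).
Implicit Types (m n : Mode d L) (S : Conf d L) (x : vec) (A B : Op).

Definition amp x S : R := x (enum_rank S) 0.

Lemma ampP x y : amp x =1 amp y -> x = y.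
Proof.
move=> xy; apply/matrixP=> i j; rewrite ord1.
by have := xy (enum_val i); rewrite /amp enum_valK.
Qed.

Lemma ampD x y S : amp (x + y) S = amp x S + amp y S.
Proof. by rewrite /amp mxE. Qed.
Lemma ampN x S : amp (- x) S = - amp x S.
Proof. by rewrite /amp mxE. Qed.
Lemma ampZ a x S : amp (a *: x) S = a * amp x S.
Proof. by rewrite /amp mxE. Qed.
Lemma amp0 S : amp 0 S = 0.
Proof. by rewrite /amp mxE. Qed.

Lemma opP A B : (forall x, A *m x = B *m x) -> A = B.
Proof.
move=> AB; apply/matrixP=> i j; have := AB (delta_mx j 0).
by rewrite -!colE => /matrixP/(_ i 0); rewrite !mxE.
Qed.

Lemma conf_rank S : conf_of (enum_rank S) = S.
Proof. exact: enum_rankK. Qed.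

Lemma amp_mul A x S : amp (A *m x) S = \sum_S' A (enum_rank S) (enum_rank S') * amp x S'.
Proof.
rewrite /amp mxE (reindex (@enum_rank (Conf d L))) //=.
by exists enum_val => y _; [apply: enum_rankK|apply: enum_valK].
Qed.

(** * Jordan-Wigner signs and the anticommutation relations *)

Definition sgn m S : R := (-1) ^+ #|[set y in S | (enum_rank y < enum_rank m)%N]|.

Lemma sgnM m S : sgn m S * sgn m S = 1.
Proof. by rewrite /sgn -expr2 sqrr_sign. Qed.

Lemma sgn_eq0 m S : (sgn m S == 0) = false.
Proof. exact: signr_eq0. Qed.

Lemma sgnU m n S : n \notin S ->
  sgn m (n |: S) = (-1) ^+ (enum_rank n < enum_rank m)%N * sgn m S.
Proof.
move=> nS; rewrite /sgn -exprD; congr (_ ^+ _).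
case: ltnP => nm.
  have -> : [set y in n |: S | (enum_rank y < enum_rank m)%N] =
    n |: [set y in S | (enum_rank y < enum_rank m)%N].
    by apply/setP=> y; rewrite !inE; case: (y =P n) => //= ->; rewrite nm.
  by rewrite cardsU1 inE (negPf nS).
congr (#|pred_of_set _|); apply/setP=> y; rewrite !inE; case: (y =P n) => //= ->.
by rewrite ltnNge nm andbF.
Qed.

Lemma sgnUx m S : sgn m (m |: S) = sgn m S.
Proof.
have [mS|mS] := boolP (m \in S); last by rewrite sgnU // ltnn mul1r.
by rewrite (setUidPr _) // sub1set.
Qed.

Lemma sgnD m n S : n \in S ->
  sgn m (S :\ n) = (-1) ^+ (enum_rank n < enum_rank m)%N * sgn m S.
Proof.
move=> nS; rewrite -{2}(setD1K nS) sgnU ?setD11 // mulrA -expr2 sqrr_sign mul1r //.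
Qed.

Lemma sgnDx m S : sgn m (S :\ m) = sgn m S.
Proof.
have [mS|mS] := boolP (m \in S); first by rewrite sgnD // ltnn mul1r.
by rewrite (setDidPl _) // disjoint_sym disjoints1.
Qed.

Lemma sign_swap (T : finType) (u v : T) : u != v ->
  (-1) ^+ (enum_rank u < enum_rank v)%N = - (-1) ^+ (enum_rank v < enum_rank u)%N :> R.
Proof.
move=> uv; have : enum_rank u != enum_rank v by rewrite (inj_eq enum_rank_inj).
by rewrite -val_eqE /=; case: ltngtP => //= _ _; rewrite ?opprK.
Qed.

Lemma amp_annih m x S : amp (c m *m x) S = if m \in S then 0 else sgn m S * amp x (m |: S).
Proof.
rewrite amp_mul; case: ifP => mS.
  apply: big1 => S' _; rewrite mxE !conf_rank /=; case: ifP => [/andP[_ /eqP E]|]; rewrite ?mul0r //.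
  by move: mS; rewrite E setD11.
rewrite (bigD1 (m |: S)) //= big1 => [|S' S'E].
  by rewrite addr0 mxE !conf_rank /= setU11 setU1K ?mS //= eqxx -/(sgn _ _) sgnUx.
rewrite mxE !conf_rank /=; case: ifP => [/andP[mS' /eqP E]|]; rewrite ?mul0r //.
by case/eqP: S'E; rewrite E setD1K.
Qed.

Lemma amp_creat m x S : amp (c' m *m x) S = if m \in S then sgn m S * amp x (S :\ m) else 0.
Proof.
rewrite amp_mul; case: ifP => mS; last first.
  by apply: big1 => S' _; rewrite !mxE !conf_rank /= mS mul0r.
rewrite (bigD1 (S :\ m)) //= big1 => [|S' S'E].
  by rewrite addr0 !mxE !conf_rank /= mS eqxx.
by rewrite !mxE !conf_rank /= mS (negPf S'E) mul0r.
Qed.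

Lemma annih_anti m n : c m *m c n = - (c n *m c m).
Proof.
apply: opP => x; apply: ampP => S; rewrite mulNmx ampN -!mulmxA !amp_annih !inE.
have [->|mn] := eqVneq m n.
  by rewrite /=; case: ifP; rewrite ?mulr0 oppr0.
rewrite /=.
case mS: (m \in S); case nS: (n \in S); rewrite ?mulr0 ?oppr0 //.
rewrite (sgnU n) ?mS // (sgnU m) ?nS // (sign_swap mn) setUCA.
by move: (_ ^+ _) (sgn m S) (sgn n S) (amp _ _) => e p q r; ring.
Qed.

Lemma annih_nil m : c m *m c m = 0.
Proof.
apply: opP => x; apply: ampP => S; rewrite -mulmxA !amp_annih !inE eqxx mul0mx amp0.
by case: ifP; rewrite ?mulr0.
Qed.

Lemma creat_nil m : c' m *m c' m = 0.
Proof. by rewrite /creat -trmx_mul annih_nil trmx0. Qed.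

Lemma annih_creat m n : c m *m c' n = (m == n)%:R%:M - c' n *m c m.
Proof.
apply: opP => x; apply: ampP => S.
rewrite mulmxBl ampD ampN mul_scalar_mx ampZ -!mulmxA.
rewrite amp_annih amp_creat [in RHS]amp_creat amp_annih !inE.
have [<-|mn] := eqVneq m n.
  rewrite /= mul1r; case: ifP => mS; last first.
    by rewrite sgnUx mulrA sgnM mul1r setU1K ?mS ?subr0.
  by rewrite sgnDx mulrA sgnM mul1r setD1K // subrr.
rewrite /= mul0r add0r.
case mS: (m \in S); case nS: (n \in S); rewrite ?mulr0 ?oppr0 //.
have -> : (m |: S) :\ n = m |: (S :\ n).
  by rewrite setDUl; congr (_ :|: _); apply/setDidPl; rewrite disjoints1 inE.
rewrite sgnU ?mS // sgnD // (sign_swap mn).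
by move: (_ ^+ _) (sgn m S) (sgn n S) (amp _ _) => e p q r; ring.
Qed.

Lemma amp_numop m x S : amp (numop R m *m x) S = (m \in S)%:R * amp x S.
Proof.
rewrite /numop -mulmxA amp_creat; case: ifP => mS; last by rewrite mul0r.
by rewrite amp_annih setD11 sgnDx mulrA sgnM setD1K.
Qed.

Lemma annih2_eq0 m n x : m != n ->
  c m *m c n *m x = 0 <-> (forall S, m \in S -> n \in S -> amp x S = 0).
Proof.
move=> mn; split=> [x0 S mS nS|xS].
  have := congr1 (fun y => amp y (S :\ n :\ m)) x0.
  rewrite -mulmxA !amp_annih !inE eqxx /= setD1K ?inE ?mn // eqxx setD1K // amp0 => /eqP; rewrite mulf_eq0 sgn_eq0 /=.
  by rewrite (eq_sym n) (negPf mn) /= mulf_eq0 sgn_eq0 => /eqP.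
apply: ampP => S; rewrite -mulmxA !amp_annih !inE amp0.
by case: ifP => // _; case: ifP => _; rewrite ?mulr0 // xS ?inE ?eqxx ?orbT // !mulr0.
Qed.

(** The operator [g(N_e)]; both [Ne] and [expmuN] have this form. *)
Definition diagN (g : nat -> R) : Op := diag_mx (\row_i g #|conf_of i|).

Lemma amp_diagN g x S : amp (diagN g *m x) S = g #|S| * amp x S.
Proof. by rewrite /amp mul_diag_mx !mxE conf_rank. Qed.

Lemma annih_diagN m g : c m *m diagN g = diagN (g \o succn) *m c m.
Proof.
apply: opP => x; apply: ampP => S; rewrite -!mulmxA amp_annih !amp_diagN amp_annih.
by case: ifP => mS; rewrite ?mulr0 //= cardsU1 mS mulrCA.
Qed.

Lemma creat_diagN m g : c' m *m diagN (g \o succn) = diagN g *m c' m.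
Proof.
apply: opP => x; apply: ampP => S; rewrite -!mulmxA amp_creat !amp_diagN amp_creat /=.
by case: ifP => mS; rewrite ?mulr0 // [in RHS](cardsD1 m) mS mulrCA.
Qed.

Lemma Ne_diagN : Ne R d L = diagN (fun k => k%:R).
Proof.
apply: opP => x; apply: ampP => S; rewrite /Ne mulmx_suml amp_diagN /amp summxE.
rewrite (eq_bigr (fun m => (m \in S)%:R * amp x S)) => [|m _]; last exact: amp_numop.
by rewrite -mulr_suml -natr_sum -sum1_card [in RHS]big_mkcond.
Qed.

Lemma diagNM g h : diagN g *m diagN h = diagN (fun k => g k * h k).
Proof. by rewrite /diagN mulmx_diag; congr diag_mx; apply/rowP=> i; rewrite !mxE. Qed.

(** * The dressing operator *)

Section Dressing.
Variables (I : eqType) (mu nu1 nu2 : I -> Mode d L) (beta : R).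
Hypotheses (mu_nu1 : forall i j, mu i != nu1 j) (mu_nu2 : forall i j, mu i != nu2 j).
Implicit Types i j : I.

Definition pairf i : Op := c (nu1 i) + c (nu2 i).
(** Moves an electron from the ends of a bond to its midpoint. Its square vanishes, so [1 + b hopX]
    has inverse [1 - b hopX]. *)
Definition hopX i : Op := c' (mu i) *m pairf i.

Lemma annih_pairf m i : c m *m pairf i = - (pairf i *m c m).
Proof. by rewrite mulmxDr mulmxDl opprD -!annih_anti. Qed.

Lemma pairf_anti i j : pairf i *m pairf j = - (pairf j *m pairf i).
Proof. by rewrite {1}/pairf mulmxDl !annih_pairf -opprD -mulmxDr. Qed.

Lemma pairf_nil i : pairf i *m pairf i = 0.
Proof.
rewrite /pairf mulmxDl !mulmxDr !annih_nil add0r addr0.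
by rewrite (annih_anti (nu2 i)) subrr.
Qed.

Lemma annih_creat_ne m n : m != n -> c m *m c' n = - (c' n *m c m).
Proof. by move=> /negPf mn; rewrite annih_creat mn raddf0 sub0r. Qed.

Lemma pairf_creat i j : pairf j *m c' (mu i) = - (c' (mu i) *m pairf j).
Proof.
by rewrite mulmxDl !annih_creat_ne 1?eq_sym // mulmxDr opprD.
Qed.

Lemma hopX_nil i : hopX i *m hopX i = 0.
Proof.
rewrite /hopX mulmxA -(mulmxA (c' _)) pairf_creat mulmxN mulmxA creat_nil mul0mx.
by rewrite oppr0 mul0mx.
Qed.

Lemma pairf_hopX i j : pairf j *m hopX i = hopX i *m pairf j.
Proof.
by rewrite /hopX mulmxA pairf_creat mulNmx -!mulmxA [in RHS]pairf_anti mulmxN.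
Qed.

Lemma annih_hopX m i : c m *m hopX i = (m == mu i)%:R *: pairf i + hopX i *m c m.
Proof.
rewrite /hopX mulmxA annih_creat mulmxBl mul_scalar_mx; congr (_ + _).
by rewrite -!mulmxA annih_pairf mulmxN opprK.
Qed.

Lemma diagN_hopX g i : diagN g *m hopX i = hopX i *m diagN g.
Proof.
rewrite /hopX mulmxA -creat_diagN -!mulmxA; congr (_ *m _).
by rewrite mulmxDl mulmxDr !annih_diagN.
Qed.

Lemma dressing (s : seq I) : exists T Ti : Op,
  [/\ T *m Ti = 1%:M, Ti *m T = 1%:M, forall j, pairf j *m T = T *m pairf j,
      forall m, c m *m T = T *m (c m + beta *: \sum_(i <- s | m == mu i) pairf i)
    & forall g, diagN g *m T = T *m diagN g].
Proof.
elim: s => [|i s [T [Ti [TTi TiT Tf Tc Tg]]]].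
  exists 1%:M, 1%:M; split=> *; rewrite ?mulmx1 ?mul1mx //.
  by rewrite big_nil scaler0 addr0.
pose Q b : Op := 1%:M + b *: hopX i.
have QQ b : Q b *m Q (- b) = 1%:M.
  rewrite /Q mulmxDl !mulmxDr !mul1mx mulmx1 -scalemxAl -scalemxAr hopX_nil !scaler0 addr0.
  by rewrite -addrA scaleNr [- _ + _]addrC subrr addr0.
have Qf j b : pairf j *m Q b = Q b *m pairf j.
  by rewrite /Q (mulmxDl 1%:M) (mulmxDr _ 1%:M) mul1mx mulmx1 -scalemxAl -scalemxAr pairf_hopX.
(* As [pairf i] squares to 0, the commutator term may carry the factor [Q b] on its left. *)
have Qfi b : Q b *m pairf i = pairf i.
  by rewrite /Q (mulmxDl 1%:M) mul1mx -scalemxAl /hopX -mulmxA pairf_nil mulmx0 scaler0 addr0.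
exists (Q beta *m T), (Ti *m Q (- beta)); split.
- by rewrite mulmxA -(mulmxA (Q _)) TTi mulmx1 QQ.
- by rewrite mulmxA -(mulmxA Ti) -{2}[beta]opprK QQ mulmx1 TiT.
- by move=> j; rewrite mulmxA Qf -!mulmxA Tf.
- move=> m; rewrite mulmxA.
  have -> : c m *m Q beta = Q beta *m (c m + (beta * (m == mu i)%:R) *: pairf i).
    rewrite [in RHS]mulmxDr -[in RHS]scalemxAr Qfi /Q [in RHS](mulmxDl 1%:M) mul1mx -scalemxAl.
    rewrite (mulmxDr _ 1%:M) mulmx1 -scalemxAr annih_hopX scalerDr scalerA.
    by rewrite [_ *: pairf i + _]addrC addrA.
  rewrite -!mulmxA; congr (_ *m _); rewrite mulmxDl Tc -scalemxAl Tf scalemxAr.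
  rewrite big_cons -mulmxDr -addrA; congr (_ *m (_ + _)).
  case: eqP => _; last by rewrite mulr0 scale0r addr0.
  by rewrite mulr1 (scalerDr _ (pairf i)) [in LHS]addrC.
- move=> g; rewrite mulmxA -!mulmxA -Tg !mulmxA; congr (_ *m _).
  by rewrite /Q (mulmxDl 1%:M) (mulmxDr _ 1%:M) mul1mx mulmx1 -scalemxAl -scalemxAr diagN_hopX.
Qed.

End Dressing.

(** * Positivity and the kernel of the Hamiltonian *)

Section Positivity.

Lemma dotE x y : (x^T *m y) 0 0 = \sum_S amp x S * amp y S.
Proof.
rewrite mxE (reindex (@enum_rank (Conf d L))) /=.
  by apply: eq_bigr => S _; rewrite mxE.
by exists enum_val => z _; [apply: enum_rankK|apply: enum_valK].
Qed.

Definition nrm x := (x^T *m x) 0 0.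

Lemma nrm_ge0 x : 0 <= nrm x.
Proof. by rewrite /nrm dotE sumr_ge0 // => S _; rewrite -expr2 sqr_ge0. Qed.

Lemma nrm_eq0 x : nrm x = 0 -> x = 0.
Proof.
rewrite /nrm dotE => /eqP; rewrite psumr_eq0 => [/allP x0|S _]; last by rewrite -expr2 sqr_ge0.
apply: ampP => S; rewrite amp0; apply/eqP; rewrite -[_ == _]orbb -mulf_eq0.
exact: (x0 S (mem_index_enum _)).
Qed.

Definition qform x A := (x^T *m (A *m x)) 0 0.

Lemma qformD x A B : qform x (A + B) = qform x A + qform x B.
Proof. by rewrite /qform mulmxDl mulmxDr mxE. Qed.
Lemma qformZ x a A : qform x (a *: A) = a * qform x A.
Proof. by rewrite /qform -scalemxAl -scalemxAr mxE. Qed.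
Lemma qform_sum x (J : finType) (F : J -> Op) : qform x (\sum_i F i) = \sum_i qform x (F i).
Proof. by rewrite /qform mulmx_suml mulmx_sumr summxE. Qed.
Lemma qform_gram x A : qform x (A^T *m A) = nrm (A *m x).
Proof. by rewrite /qform /nrm trmx_mul -!mulmxA. Qed.
Lemma qform_numop2 x m n :
  qform x (numop R m *m numop R n) = nrm (numop R m *m numop R n *m x).
Proof.
rewrite /qform /nrm !dotE; apply: eq_bigr => S _; rewrite -!(mulmxA (numop R m) (numop R n) x) !amp_numop.
by case: (m \in S); case: (n \in S); rewrite ?mul0r ?mulr0 ?mul0r ?mul1r.
Qed.

(** Each term of the quadratic form is a positive multiple of a squared norm, so a zero sum kills
    every term. *)
Lemma ham_ker (t lam U U' : R) x : 0 < t -> 0 < U -> 0 < U' ->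
  Ham d L t lam U U' *m x = 0 <->
  (forall b s, aop lam b s *m x = 0) /\
  (forall y : Site d L, numop R (y, true) *m numop R (y, false) *m x = 0).
Proof.
move=> t0 U0 U'0; split=> [Hx|[ax nx]]; last first.
  rewrite /Ham /Hhop /Hint !mulmxDl -!scalemxAl !mulmx_suml.
  rewrite big1 => [|s _]; last first.
    rewrite mulmx_suml big1 // => b _.
    by rewrite -scalemxAl -mulmxA ax mulmx0 scaler0.
  rewrite !big1 ?scaler0 ?addr0 // => y _; exact: nx.
have : qform x (Ham d L t lam U U') = 0 by rewrite /qform Hx mulmx0 mxE.
rewrite /Ham /Hhop /Hint !qformD !qformZ !qform_sum.
under eq_bigr do rewrite qform_sum.
under eq_bigr do under eq_bigr do rewrite qformZ qform_gram.
under [X in _ + (_ * X + _)]eq_bigr do rewrite qform_numop2.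
under [X in _ + (_ + _ * X)]eq_bigr do rewrite qform_numop2.
have hop_ge0 s b : 0 <= t * nrm (aop lam b s *m x) by rewrite mulr_ge0 ?nrm_ge0 // ltW.
have hop2_ge0 s : 0 <= \sum_b t * nrm (aop lam b s *m x) by apply: sumr_ge0.
set A := \sum_s _; set B := \sum_u _; set C := \sum_b _ => ABC.
have A0 : 0 <= A by rewrite sumr_ge0.
have B0 : 0 <= B by apply: sumr_ge0 => *; apply: nrm_ge0.
have C0 : 0 <= C by apply: sumr_ge0 => *; apply: nrm_ge0.
have UB0 := mulr_ge0 (ltW U0) B0; have UC0 := mulr_ge0 (ltW U'0) C0.
have A00 : A = 0 by lra.
have /eqP : U * B = 0 by lra.
rewrite mulf_eq0 gt_eqF //= => /eqP B00.
have /eqP : U' * C = 0 by lra.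
rewrite mulf_eq0 gt_eqF //= => /eqP C00.
split=> [b s|[u|b]]; apply: nrm_eq0.
- have := @psumr_eq0P _ _ _ _ (fun s _ => hop2_ge0 s) A00 s isT.
  move=> /(psumr_eq0P (fun b _ => hop_ge0 s b)) /(_ b isT)/eqP.
  by rewrite mulf_eq0 gt_eqF //= => /eqP.
- exact: (@psumr_eq0P _ _ _ _ (fun _ _ => nrm_ge0 _) B00 u isT).
- exact: (@psumr_eq0P _ _ _ _ (fun _ _ => nrm_ge0 _) C00 b isT).
Qed.

End Positivity.
End Fock.

(** * The zero-energy space *)

Section GroundSpace.
Variables (R : realType) (d L : nat).
Hypothesis L_gt1 : (1 < L)%N.
Local Notation V := (Vtx d L).
Local Notation Op := (Op R d L).
Local Notation vec := ('cV[R]_(fdim d L)).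
Local Notation c := (@annih R d L).
Local Notation spins := (spins V).
Implicit Types (S : Conf d L) (x phi : vec) (g h : spins) (u v w : V) (b : Bond d L).

Local Notation vm v s := ((vsite v, s) : Mode d L).
Local Notation mm b s := ((msite b, s) : Mode d L).

Definition mid (i : Bond d L * bool) : Mode d L := mm i.1 i.2.
Definition fst_end (i : Bond d L * bool) : Mode d L := vm i.1.1 i.2.
Definition snd_end (i : Bond d L * bool) : Mode d L := vm (shift i.1.1 i.1.2) i.2.
Local Notation ends := (pairf R fst_end snd_end).

(** The zero-energy conditions transported by [T^-1]; the last one comes from double occupancy of a
    midpoint. *)
Definition reduced phi : Prop :=
  [/\ forall b s, c (mm b s) *m phi = 0,
      forall v, c (vm v true) *m c (vm v false) *m phi = 0
    & forall b, ends (b, true) *m ends (b, false) *m phi = 0].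

Lemma numop2_eq0 (m n : Mode d L) x : m != n ->
  numop R m *m numop R n *m x = 0 <-> c m *m c n *m x = 0.
Proof.
move=> mn; rewrite annih2_eq0 //; split=> [nx S mS nS|xS].
  have := congr1 (fun y => amp y S) nx.
  by rewrite -(mulmxA (numop R m) (numop R n) x) !amp_numop mS nS !mul1r amp0.
apply: ampP => S; rewrite -(mulmxA (numop R m) (numop R n) x) !amp_numop amp0.
by case mS: (m \in S); case nS: (n \in S); rewrite ?mul0r ?mulr0 // xS // !mulr0.
Qed.

Lemma dressed_kernel (lam : R) : lam != 0 -> exists T Ti : Op,
  [/\ T *m Ti = 1%:M, Ti *m T = 1%:M, forall f : nat -> R, diagN d L f *m T = T *m diagN d L f
    & forall phi,
      (forall b s, aop lam b s *m (T *m phi) = 0) /\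
      (forall y : Site d L, numop R (y, true) *m numop R (y, false) *m (T *m phi) = 0)
      <-> reduced phi].
Proof.
(* Since [lam beta = -1], the dressed midpoint operator cancels the two end operators in [aop]. *)
move=> lam0; pose beta := - lam^-1.
have b0 : beta != 0 by rewrite oppr_eq0 invr_eq0.
have ud (y : Site d L) : (y, true) != (y, false) :> Mode d L by rewrite xpair_eqE andbF.
have mid1 i j : mid i != fst_end j by [].
have mid2 i j : mid i != snd_end j by [].
have [T [Ti [TTi TiT Tf Tc Tg]]] := dressing beta mid1 mid2 (enum {: Bond d L * bool}).
exists T, Ti; split=> // phi.
have Tinj y : T *m y = 0 <-> y = 0.
  by split=> [Ty|->]; rewrite ?mulmx0 // -[y]mul1mx -TiT -mulmxA Ty mulmx0.
have Tv v s : c (vm v s) *m T = T *m c (vm v s).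
  by rewrite Tc big_pred0 ?scaler0 ?addr0.
have Tm b s : c (mm b s) *m T = T *m (c (mm b s) + beta *: ends (b, s)).
  rewrite Tc (eq_bigl (pred1 (b, s))); last first.
    by move=> [b' s']; rewrite /mid /= !xpair_eqE eq_sym [s == _]eq_sym.
  by rewrite big_enum_cond /= big_pred1_eq.
have aT b s : aop lam b s *m T = T *m (lam *: c (mm b s)).
  rewrite /aop mulmxDl -scalemxAl Tm -[c _ + c _]/(ends (b, s)) Tf.
  rewrite [in LHS]scalemxAr -(mulmxDr T); congr (_ *m _).
  by rewrite scalerDr scalerA mulrN mulfV // scaleN1r addrC -addrA addNr addr0.
(* On states with empty midpoints, the dressed [c (mm b s)] acts as [beta] times [ends (b, s)]. *)
have D b : (forall s, c (mm b s) *m phi = 0) ->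
    c (mm b true) *m c (mm b false) *m (T *m phi) = 0 <->
    ends (b, true) *m ends (b, false) *m phi = 0.
  move=> c0.
  have -> : c (mm b true) *m c (mm b false) *m (T *m phi)
      = T *m (beta ^+ 2 *: (ends (b, true) *m ends (b, false) *m phi)).
    rewrite -mulmxA (mulmxA _ T) Tm -!mulmxA (mulmxA _ T) Tm -!mulmxA; congr (_ *m _).
    rewrite [in X in _ *m X]mulmxDl c0 add0r -scalemxAl -scalemxAr mulmxDl.
    rewrite (mulmxA (c _)) annih_pairf mulNmx -mulmxA c0 mulmx0 oppr0 add0r.
    by rewrite -scalemxAl scalerA mulmxA.
  rewrite Tinj; split=> [/eqP|->]; last by rewrite scaler0.
  by rewrite scaler_eq0 expf_eq0 (negPf b0) => /eqP.
have Dv v : c (vm v true) *m c (vm v false) *m (T *m phi) = 0 <->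
    c (vm v true) *m c (vm v false) *m phi = 0.
  rewrite -(Tinj _ (c _ *m _ *m phi)) -(mulmxA (c (vm v true))).
  rewrite (mulmxA _ T) Tv -!mulmxA (mulmxA _ T) Tv -!mulmxA. by split.
split=> [[ax nx]|[c0 dv db]].
  have c0 b s : c (mm b s) *m phi = 0.
    have := ax b s; rewrite mulmxA aT -mulmxA Tinj -scalemxAl => /eqP.
    by rewrite scaler_eq0 (negPf lam0) => /eqP.
  split=> // [v|b]; first exact/Dv/(numop2_eq0 _ (ud _))/nx.
  exact/(D b (c0 b))/(numop2_eq0 _ (ud _))/nx.
split=> [b s|[v|b]]; first by rewrite mulmxA aT -mulmxA -scalemxAl c0 scaler0 mulmx0.
  exact/(numop2_eq0 _ (ud _))/Dv.
exact/(numop2_eq0 _ (ud _))/(D b (c0 b)).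
Qed.

Definition enc g : Conf d L :=
  [set m | if m is (inl v, s) then g v == Some s else false].
(** A doubly occupied vertex is read as up and midpoints are ignored, so [enc (dec S) = S] singles
    out the encodings. *)
Definition dec S : spins :=
  [ffun v => if vm v true \in S then Some true
             else if vm v false \in S then Some false else None].

Lemma enc_vm g v s : (vm v s \in enc g) = (g v == Some s).
Proof. by rewrite inE. Qed.

Lemma enc_mm g b s : (mm b s \in enc g) = false.
Proof. by rewrite inE. Qed.

Lemma encK : cancel enc dec.
Proof. by move=> g; apply/ffunP=> v; rewrite ffunE !enc_vm; case: (g v) => [[]|]. Qed.

Lemma enc_dec S : (forall b s, mm b s \notin S) ->
  (forall v, ~~ ((vm v true \in S) && (vm v false \in S))) -> enc (dec S) = S.
Proof.
move=> noM noD; apply/setP=> -[[v|b] s]; last by rewrite enc_mm (negPf (noM b s)).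
rewrite enc_vm ffunE; have := noD v.
by case: s; case: (vm v true \in S); case: (vm v false \in S).
Qed.

Lemma enc_upd g v s : g v = None -> enc (upd g v (Some s)) = vm v s |: enc g.
Proof.
move=> gv; apply/setP=> -[[u|b] s']; rewrite in_setU1 ?enc_mm // !enc_vm ffunE xpair_eqE.
have -> : (vsite u == vsite v) = (u == v) by [].
by case: (u =P v) => [->|] //=; rewrite gv orbF eq_sym.
Qed.

Lemma card_enc g : #|enc g| = #|occ g|.
Proof.
pose f v : Mode d L := vm v (odflt true (g v)).
have <- : f @: occ g = enc g; last by apply: card_imset => v w [].
apply/setP=> -[[v|b] s]; last by rewrite enc_mm; apply/imsetP=> -[].
rewrite enc_vm; apply/imsetP/eqP => [[w] + [-> ->]|gv]; first by rewrite inE; case: (g w).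
by exists v; rewrite /f ?inE gv.
Qed.

(* [enum_rank] on [Site * bool] is site-major: on states without double occupancy the
   Jordan-Wigner signs do not see the spins, and exchange acts without signs. *)
Lemma sgn_enc v s s' g : g v = None -> sgn R (vm v s) (enc g) = sgn R (vm v s') (enc g).
Proof.
move=> gv; rewrite /sgn; congr (_ ^+ _); apply: eq_card => -[[u|b] s'']; rewrite !inE //.
case: (u =P v) => [->|/eqP uv]; first by rewrite gv.
by rewrite !enum_rank_pair_lt.
Qed.

Definition symmetric_state phi : Prop :=
  (forall S, enc (dec S) != S -> amp phi S = 0) /\
  (forall g g', swap (@nbr d L) g g' -> amp phi (enc g) = amp phi (enc g')).

Definition up_down v w g : spins := upd (upd g v (Some true)) w (Some false).

Lemma exch_up_down v w g : v != w -> exch (up_down v w g) v w = up_down w v g.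
Proof.
move=> vw; apply/ffunP=> u; rewrite !ffunE; case: tpermP => [->|->|].
- by rewrite !eqxx.
- by rewrite !eqxx (eq_sym w) (negPf vw).
- by move=> /eqP/negPf -> /eqP/negPf ->.
Qed.

Lemma amp_pair v w g phi : v != w -> g v = None -> g w = None ->
  amp (c (vm v true) *m (c (vm w false) *m phi)) (enc g)
  = (-1) ^+ (enum_rank (vsite v) < enum_rank (vsite w))%N
    * (sgn R (vm v true) (enc g) * sgn R (vm w true) (enc g)) * amp phi (enc (up_down v w g)).
Proof.
move=> vw gv gw; have vwm : (vm w false == vm v true) = false by rewrite xpair_eqE andbF.
rewrite !amp_annih enc_vm gv in_setU1 vwm enc_vm gw /=.
rewrite sgnU ?enc_vm ?gv // enum_rank_pair_lt ?(inj_eq inl_inj) //.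
rewrite (sgn_enc false true gw) /up_down !enc_upd //; last by rewrite ffunE eq_sym (negPf vw).
move: (_ ^+ _) (sgn _ _ _) (sgn _ _ _) (amp _ _) => e p q r; ring.
Qed.

(** Of the four terms of the product, the two on a single vertex vanish. The mixed ones are related
    by exchanging [v] and [w], which flips the ordering sign: hence a difference. *)
Lemma ends_amp b phi g (v := b.1) (w := shift b.1 b.2) :
  (forall v, c (vm v true) *m c (vm v false) *m phi = 0) -> g v = None -> g w = None ->
  exists2 e : R, e != 0 &
  amp (ends (b, true) *m ends (b, false) *m phi) (enc g)
    = e * (amp phi (enc (up_down v w g)) - amp phi (enc (up_down w v g))).
Proof.
move=> dv gv gw; have vw : v != w by rewrite eq_sym shift_neq.
exists ((-1) ^+ (enum_rank (vsite v) < enum_rank (vsite w))%N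
    * (sgn R (vm v true) (enc g) * sgn R (vm w true) (enc g))).
  by rewrite !mulf_neq0 ?sgn_eq0 // signr_eq0.
rewrite /pairf /fst_end /snd_end /= -/v -/w mulmxDl !mulmxDr !mulmxDl !dv add0r addr0.
have wv' : w != v by rewrite eq_sym.
rewrite ampD -!mulmxA (amp_pair phi vw gv gw) (amp_pair phi wv' gw gv).
have wv : vsite w != vsite v by rewrite (inj_eq inl_inj) eq_sym.
rewrite (sign_swap R wv).
move: (_ ^+ _) (sgn _ _ _) (sgn _ _ _) (amp _ _) (amp _ _) => e p q r s; ring.
Qed.

Lemma annih_eq0 (m : Mode d L) x : c m *m x = 0 <-> (forall S, m \in S -> amp x S = 0).
Proof.
split=> [x0 S mS|xS].
  have := congr1 (fun y => amp y (S :\ m)) x0.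
  rewrite amp_annih setD11 setD1K // amp0 => /eqP.
  by rewrite mulf_eq0 sgn_eq0 => /eqP.
by apply: ampP => S; rewrite amp_annih amp0; case: ifP => // _; rewrite xS ?mulr0 ?setU11.
Qed.

Lemma up_downK v w g : v != w -> g v = Some true -> g w = Some false ->
  up_down v w (upd (upd g v None) w None) = g.
Proof.
move=> vw gv gw; apply/ffunP=> u; rewrite !ffunE.
by case: (u =P w) => [->|_]; [rewrite gw|case: (u =P v) => [->|]].
Qed.

(** A nonzero amplitude would come from an encoding with [v] up and [w] down; emptying both sites
    would give [h] with [enc h = S]. *)
Lemma amp_pair0 v w S phi : v != w -> symmetric_state phi ->
  (forall h, h v = None -> h w = None -> enc h != S) ->
  amp (c (vm v true) *m (c (vm w false) *m phi)) S = 0.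
Proof.
move=> vw [phi0 _] noS; rewrite !amp_annih.
case: ifP => // vS; case: ifP => [_|wS]; first by rewrite mulr0.
set S' := _ |: (_ |: S); have [S'E|/phi0 ->] := eqVneq (enc (dec S')) S'; last by rewrite !mulr0.
set g := dec S' in S'E.
have gv : g v = Some true by apply/eqP; rewrite -enc_vm S'E !inE eqxx orbT.
have gw : g w = Some false by apply/eqP; rewrite -enc_vm S'E !inE eqxx.
pose h := upd (upd g v None) w None.
have hv : h v = None by rewrite /h !ffunE eqxx (negPf vw).
have hw : h w = None by rewrite /h !ffunE eqxx.
case/eqP: (noS h hv hw).
have := S'E; rewrite -(up_downK vw gv gw) -/h /up_down !enc_upd //; last first.
  by rewrite ffunE eq_sym (negPf vw).
move=> /(congr1 (fun X => X :\ vm w false :\ vm v true)).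
rewrite !setU1K ?wS ?vS ?enc_vm ?hv //.
by rewrite in_setU1 enc_vm hw xpair_eqE andbF.
Qed.

Lemma swap_up_down b h : h b.1 = None -> h (shift b.1 b.2) = None ->
  swap (@nbr d L) (up_down b.1 (shift b.1 b.2) h) (up_down (shift b.1 b.2) b.1 h).
Proof.
set v := b.1; set w := shift _ _ => hv hw.
have vw : v != w by rewrite eq_sym shift_neq.
apply/swapP; exists v, w; rewrite exch_up_down // nbr_shift !inE !ffunE !eqxx.
by rewrite (negPf vw).
Qed.

(** By [ends_amp] the bond conditions equate amplitudes that differ by exchanging opposite spins;
    equal spins exchange trivially. *)
Lemma reduced_symmetric phi : reduced phi <-> symmetric_state phi.
Proof.
split=> [[c0 dv db]|sym].
  split=> [S|g g' /swapP[v [w [vw vg wg ->]]]].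
    apply: contraNeq => ampS; apply/eqP/enc_dec => [b s|v]; apply: contra_neqN ampS.
      by move=> bS; have /annih_eq0 -> := c0 b s.
    by move=> /andP[tS fS]; have /annih2_eq0 -> := dv v; rewrite // xpair_eqE andbF.
  have key b h (x := b.1) (y := shift b.1 b.2) : h x = None -> h y = None ->
      amp phi (enc (up_down x y h)) = amp phi (enc (up_down y x h)).
    move=> hx hy; have [e e0] := ends_amp dv hx hy.
    rewrite db amp0 => /esym/eqP; rewrite mulf_eq0 (negPf e0) subr_eq0 => /eqP //.
  have {}key h : h v = None -> h w = None ->
      amp phi (enc (up_down v w h)) = amp phi (enc (up_down w v h)).
    move=> hv hw; case/existsP: vw => k /orP[/eqP wE|/eqP vE].
      by rewrite wE in hw *; apply: (key (v, k)).
    by rewrite vE in hv *; apply/esym/(key (w, k)).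
  have vNw : v != w by apply: contraTneq vw => ->; rewrite nbrnn.
  have wNv : w != v by rewrite eq_sym.
  have nn u u' (f : spins) : u != u' ->
      upd (upd f u None) u' None u = None /\ upd (upd f u None) u' None u' = None.
    by move=> /negPf uu'; rewrite !ffunE !eqxx uu'.
  move: vg wg; rewrite !inE.
  case gv: (g v) => [s|] // _; case gw: (g w) => [s'|] // _.
  have [ss'|] := eqVneq s s'.
    congr (amp _ (enc _)); apply/ffunP=> u; rewrite ffunE.
    by case: tpermP => // ->; rewrite gv gw ss'.
  case: s s' gv gw => [] [] // gv gw _.
    rewrite -(up_downK vNw gv gw) exch_up_down //.
    by apply: key; have [] := nn v w g vNw.
  have -> : exch g v w = exch g w v by apply/ffunP=> u; rewrite !ffunE tpermC.
  rewrite -(up_downK wNv gw gv) exch_up_down //.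
  by apply/esym/key; have [] := nn w v g wNv.
have dv v : c (vm v true) *m c (vm v false) *m phi = 0.
  apply/annih2_eq0 => [|S tS fS]; first by rewrite xpair_eqE andbF.
  apply: sym.1; apply: contraTneq tS => SE; move: fS; rewrite -SE !enc_vm.
  by move=> /eqP ->.
split=> // [b s|b].
  apply/annih_eq0 => S bS; apply: sym.1.
  by apply: contraTneq bS => <-; rewrite enc_mm.
have vw : b.1 != shift b.1 b.2 by rewrite eq_sym shift_neq.
have wv : shift b.1 b.2 != b.1 by rewrite shift_neq.
apply: ampP => S; rewrite amp0.
have [/existsP[h /and3P[/eqP hv /eqP hw /eqP <-]]|] :=
  boolP [exists h : spins, [&& h b.1 == None, h (shift b.1 b.2) == None & enc h == S]].
  have [e _ ->] := ends_amp dv hv hw.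
  by rewrite (sym.2 _ _ (swap_up_down hv hw)) subrr mulr0.
rewrite negb_exists => /forallP noS.
rewrite /pairf /fst_end /snd_end /= mulmxDl !mulmxDr !mulmxDl !dv add0r addr0.
rewrite ampD -!mulmxA !amp_pair0 ?addr0 // => h h1 h2.
  by have := noS h; rewrite h1 h2 !eqxx.
by have := noS h; rewrite h1 h2 !eqxx.
Qed.

(** * Class average and traces over the ground space *)

Local Notation eqv := (connect (swap (@nbr d L))).
Local Notation om := (omega (@nbr d L) R).

(** Averages amplitudes over exchange classes and kills all other configurations: an idempotent
    whose range is the symmetric states. *)
Definition avg : Op := \matrix_(i, j)
  (let S := conf_of i in let S' := conf_of j in
   if [&& enc (dec S) == S, enc (dec S') == S' & eqv (dec S) (dec S')]
   then om (dec S) else 0).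

Lemma amp_avg x S : amp (avg *m x) S =
  if enc (dec S) == S then om (dec S) * \sum_(g | eqv (dec S) g) amp x (enc g) else 0.
Proof.
rewrite amp_mul; under eq_bigr do rewrite mxE !conf_rank /=.
case: ifP => _ /=; last by apply: big1 => *; rewrite mul0r.
rewrite (bigID (fun S' => enc (dec S') == S')) /= addrC big1 ?add0r; last first.
  by move=> S' /negPf ->; rewrite mul0r.
rewrite (reindex_onto enc dec) /= => [|S' /eqP //].
rewrite (eq_bigl predT) => [|g]; last by rewrite encK !eqxx.
rewrite mulr_sumr [RHS]big_mkcond /=; apply: eq_bigr => g _.
by rewrite encK eqxx /=; case: ifP; rewrite ?mul0r.
Qed.

Lemma amp_avg_enc x g : amp (avg *m x) (enc g) = om g * \sum_(h | eqv g h) amp x (enc h).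
Proof. by rewrite amp_avg encK eqxx. Qed.

Lemma avg_sym x : symmetric_state (avg *m x).
Proof.
split=> [S /negPf nS|g g' gg']; first by rewrite amp_avg nS.
rewrite !amp_avg_enc (omega_eqv R (connect1 gg')); congr (_ * _).
by apply: eq_bigl => h; rewrite (same_connect (@eqv_sym _ _) (connect1 gg')).
Qed.

Lemma avg_fix x : avg *m x = x <-> symmetric_state x.
Proof.
split=> [<-|[x0 xs]]; first exact: avg_sym.
apply: ampP => S; rewrite amp_avg.
case: eqP => [SE|/eqP nS]; last by rewrite x0.
have xc g h : eqv g h -> amp x (enc h) = amp x (enc g).
  move=> ch; pose Q h := amp x (enc h) = amp x (enc g).
  by apply: (connect_ind (Q := Q) _ ch); rewrite /Q // => a b <- /xs.
rewrite (eq_bigr (fun=> amp x (enc (dec S)))) => [|h /xc //].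
rewrite sumr_const -mulr_natl mulrA mulVf ?mul1r ?SE //.
by rewrite pnatr_eq0 -lt0n card_class_gt0.
Qed.

Lemma avg_idem : avg *m avg = avg.
Proof. by apply: opP => x; rewrite -mulmxA; apply/avg_fix/avg_sym. Qed.

Lemma diagN_avg f : diagN d L f *m avg = avg *m diagN d L f.
Proof.
apply: opP => x; apply: ampP => S; rewrite -!mulmxA amp_diagN !amp_avg.
case: eqP => [SE|_]; rewrite ?mulr0 // mulrCA mulr_sumr; congr (_ * _).
apply: eq_bigr => g /occ_eqv og.
by rewrite amp_diagN -{1}SE !card_enc og.
Qed.

Lemma trace_avg f : \tr (diagN d L f *m avg) = \sum_g f #|occ g| * om g.
Proof.
rewrite /mxtrace (reindex (@enum_rank (Conf d L))) /=; last first.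
  by exists enum_val => z _; [apply: enum_rankK|apply: enum_valK].
under eq_bigr do rewrite mul_diag_mx !mxE !conf_rank /=.
rewrite (bigID (fun S => enc (dec S) == S)) /= addrC big1 ?add0r; last first.
  by move=> S /negPf ->; rewrite mulr0.
rewrite (reindex_onto enc dec) /= => [|S' /eqP //].
rewrite (eq_bigl predT) => [|g]; last by rewrite encK !eqxx.
by apply: eq_bigr => g _; rewrite encK !eqxx connect0 card_enc.
Qed.

(** [T avg T^-1] is an idempotent with the range of [P] and commutes with [f(N_e)]; it may replace
    [P] in the trace, and then [T] drops out. *)
Lemma trace_ground (t lam U U' : R) (P : Op) (f : nat -> R) :
  0 < t -> 0 < lam -> 0 < U -> 0 < U' -> is_ground_proj (Ham d L t lam U U') P ->
  \tr (diagN d L f *m P) = \sum_g f #|occ g| * om g.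
Proof.
move=> t0 lam0 U0 U'0 [_ [PP kerP]].
have [T [Ti [TTi TiT Tg Tker]]] := dressed_kernel (lt0r_neq0 lam0).
have kerE (y : vec) : Ham d L t lam U U' *m (T *m y) = 0 <-> avg *m y = y.
  apply: iff_trans (ham_ker _ _ t0 U0 U'0) _; apply: iff_trans (Tker y) _.
  exact: iff_trans (reduced_symmetric y) (iff_sym (avg_fix y)).
(* Idempotents with the same range: [P P' = P'] and [P' P = P] *)
pose P' := T *m avg *m Ti.
have PP' : P *m P' = P'.
  apply: opP => x; rewrite -mulmxA; apply/kerP; rewrite /P' -!mulmxA.
  by apply/kerE; rewrite mulmxA avg_idem.
have P'P : P' *m P = P.
  apply: opP => x; rewrite -mulmxA; have : avg *m (Ti *m (P *m x)) = Ti *m (P *m x).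
    by apply/kerE; rewrite (mulmxA T) TTi mul1mx; apply/kerP; rewrite mulmxA PP.
  by rewrite /P' -!mulmxA => ->; rewrite (mulmxA T) TTi mul1mx.
have gTi : diagN d L f *m Ti = Ti *m diagN d L f.
  by rewrite -[LHS]mul1mx -TiT -mulmxA (mulmxA T) -Tg -!mulmxA TTi mulmx1.
have gP' : diagN d L f *m P' = P' *m diagN d L f.
  by rewrite /P' !mulmxA Tg -!mulmxA -gTi !mulmxA -(mulmxA T) diagN_avg !mulmxA.
(* With [g = f(N_e)]: [tr (g P) = tr (g P' P) = tr (P' g P) = tr (g P P') = tr (g P')]. *)
rewrite -P'P mulmxA gP' -mulmxA mxtrace_mulC -mulmxA PP' /P'.
by rewrite !mulmxA Tg -!mulmxA mxtrace_mulC -!mulmxA TiT mulmx1 trace_avg.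
Qed.

Lemma gc_avg_ground (t lam U U' : R) (P : Op) (mu : R) :
  0 < t -> 0 < lam -> 0 < U -> 0 < U' -> is_ground_proj (Ham d L t lam U U') P ->
  gc_avg P mu (Ne R d L) = Nsum (@nbr d L) (expR mu) / Zsum (@nbr d L) (expR mu).
Proof.
move=> t0 lam0 U0 U'0 Pg; rewrite /gc_avg Ne_diagN.
have -> : expmuN d L mu = diagN d L (fun k => expR mu ^+ k).
  by congr diag_mx; apply/rowP=> i; rewrite !mxE mulrC expRM_natl.
rewrite diagNM !(trace_ground _ t0 lam0 U0 U'0 Pg); congr (_ / _).
by apply: eq_bigr => g _; rewrite mulrA.
Qed.

End GroundSpace.

(** * From traces to the density bounds *)

Theorem theorem2p4 (R : realType) :
  (forall (d L : nat), (1 <= d)%N -> (4 <= L)%N -> ~~ odd L ->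
   forall (t lam U U' : R), 0 < t -> 0 < lam -> 0 < U -> 0 < U' ->
   forall P : Op R d L, is_ground_proj (Ham d L t lam U U') P ->
   forall mu : R,
     (1 + expR (- mu) / 2)^-1 >= gc_avg P mu (Ne R d L) / (L ^ d)%:R /\
     gc_avg P mu (Ne R d L) / (L ^ d)%:R >= 3%:R ^- d * (1 + expR (- mu) / 2)^-1)
  /\
  (forall d : nat, (2 <= d)%N ->
   exists mu1 c1 : R, 0 < mu1 /\ 0 < c1 /\
   forall L : nat, (4 <= L)%N -> ~~ odd L ->
   forall (t lam U U' : R), 0 < t -> 0 < lam -> 0 < U -> 0 < U' ->
   forall P : Op R d L, is_ground_proj (Ham d L t lam U U') P ->
   forall mu : R, mu1 <= mu ->
     gc_avg P mu (Ne R d L) / (L ^ d)%:R >= 1 - c1 * expR (- mu)).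
Proof.
split=> [d L d1 L4 _ t lam U U' t0 lam0 U0 U'0 P Pg mu|d d2].
  have L1 : (1 < L)%N by apply: leq_trans L4.
  have N0 : 0 < (L ^ d)%:R :> R by rewrite ltr0n expn_gt0 ltnW.
  rewrite (gc_avg_ground L1 mu t0 lam0 U0 U'0 Pg).
  have z0 := expR_gt0 mu; have Z0 := Zsum_gt0 (@nbr d L) z0.
  have NZ0 := mulr_gt0 N0 Z0.
  rewrite expRN -/(rho (expR mu)) -mulrA -invfM [Zsum _ _ * _]mulrC; split.
    by rewrite ler_pdivrMr // mulrA -card_torus Nsum_le.
  rewrite ler_pdivlMr // -mulrA ler_pdivrMl ?exprn_gt0 // (mulrA (rho _)) -card_torus.
  apply: (le_trans (Nsum_ge (@nbr_sym d L) (nbrnn L1) z0 (@deg_nbr d L))).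
  rewrite -natrX ler_wpM2r ?ler_nat //.
    by apply: sumr_ge0 => g _; rewrite mulr_ge0 // ltW // wt_gt0.
  (* [2 d + 1 <= 3 ^ d], by induction on [d]. *)
  by elim: d {d1 P Pg N0 Z0 NZ0} => // d; rewrite expnS; lia.
(* [c1 = e 2^(c D)] with isoperimetric constant [c = d] and degree bound [D = 2 d]. *)
exists 1, (expR 1 * (2 ^ (d * (d + d)))%:R); split=> //; split.
  by rewrite mulr_gt0 ?expR_gt0 // ltr0n expn_gt0.
move=> L L4 _ t lam U U' t0 lam0 U0 U'0 P Pg mu _.
have L1 : (1 < L)%N by apply: leq_trans L4.
have N0 : 0 < (L ^ d)%:R :> R by rewrite ltr0n expn_gt0 ltnW.
rewrite (gc_avg_ground L1 mu t0 lam0 U0 U'0 Pg).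
have z0 := expR_gt0 mu; have Z0 := Zsum_gt0 (@nbr d L) z0.
have NZ0 := mulr_gt0 N0 Z0.
have := holes_le (@nbr_sym d L) (@deg_nbr d L) (fun C => isoperimetry d2) z0.
rewrite expRN -[_ / _ / (L ^ d)%:R]mulrA -invfM [Zsum _ _ * _]mulrC ler_pdivlMr // card_torus /=.
set K := _%:R; set N := _%:R; lra.
Qed.
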